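(* Let $\gamma$ be a general critical curve (of the total CR twist functional) of type $\mathcal B_1'$ with modulus $\mathbf c=(c_1,c_2)$. Let $e_1<e_2<e_3$ be the real roots of $P_{\mathbf c}$ and $\lambda_1=-(\lambda_2+\lambda_3)<0<\lambda_2<\lambda_3$ the roots of $Q_{\mathbf c}$. Then $\gamma$ is closed if and only if the complete hyperelliptic integrals $$\mathfrak P_j=\frac1\pi\int_{e_2}^{e_1}\frac{\sqrt3\,\bigl(3c_1\lambda_j-(4c_1+\lambda_j^2)\tau^2+3\tau^3\bigr)}{\sqrt2\,\tau\,(3\lambda_j-\tau^2)\sqrt{P_{\mathbf c}(\tau)}}\,d\tau,\qquad j=1,2,3,$$ are all rational numbers.
   Context: $\mathbb C^{2,1}$ denotes $\mathbb C^3$ with the Hermitian form $\langle \mathbf z,\mathbf w\rangle={}^t\overline{\mathbf z}\,\mathbf h\,\mathbf w$, $\mathbf h=\begin{pmatrix}0&0&i\\0&1&0\\-i&0&0\end{pmatrix}$ (signature $(2,1)$). $\mathcal S\subset\mathbb{CP}^2$ is the set of null lines, $\mathcal S=\{[\mathbf z]: \langle\mathbf z,\mathbf z\rangle=0\}\cong S^3$. $G=\{A\in SL(3,\mathbb C): {}^t\bar A\mathbf hA=\mathbf h\}$ acts on $\mathcal S$ by $A[\mathbf z]=[A\mathbf z]$. The contact distribution $\mathcal D$ of $\mathcal S$ is the kernel of the real 1-form $\zeta$ obtained by restricting $-i\langle\mathbf z,d\mathbf z\rangle/(\overline{\mathbf z}\cdot\mathbf z)$ to $T\mathcal S$. A smooth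 immersed curve $\gamma\colon J\to\mathcal S$ is transversal if $\gamma'(t)\notin\mathcal D_{\gamma(t)}$ for all $t$; it is always assumed positively parametrized, i.e. $\zeta(\gamma')>0$. A lift of $\gamma$ is a smooth map $\Gamma$ into the nonzero null vectors with $\gamma=[\Gamma]$. A transversal curve is generic if $\det(\Gamma,\Gamma',\Gamma'')\neq0$ everywhere for one (hence any) lift. A Wilczynski lift is a lift with $\det(\Gamma,\Gamma',\Gamma'')=-1$. The infinitesimal strain is $ds=a_\gamma\,dt$, where $a_\gamma=i\langle\Gamma,\Gamma'\rangle^{-1}>0$ for a Wilczynski lift $\Gamma$; the curve is parametrized by the natural parameter if $a_\gamma=1$. For such a generic transversal curve there is a smooth map $\mathcal F=(F_1,F_2,F_3)\colon J\to G$ (a Wilczynski frame, unique up to a constant cube root of unity), with $F_1$ a Wilczynski lift, such that $$\mathcal F^{-1}\mathcal F'=\begin{pmatrix} i\kappa & -i & \tau\\ 0 & -2i\kappa & 1\\ 1 & 0 & i\kappa\end{pmatrix}$$ for smooth real functions $\kappa$ (bending) and $\tau$ (twist). The total CR twist functional is $\mathcal W[\gamma]=\int\tau\,ds$; critical curves are its critical points with respect to compactly supported variations through generic transversal curves. Equivalently, $2\kappa\tau'+\tau\kappa'=0$ and $\tau''+9\kappa(1-\tau\kappa)-\tau^2=0$. Critical curves are taken on their maximal interval of definition, parametrized by the natural parameter. Along a critical curve the quantities $c_1=\kappa\tau^2$ and $c_2=-18\kappa\tau+9\kappa^2\tau^2-\tfrac23\tau^3+\tau'^2$ are constant, and $\mathbf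 c=(c_1,c_2)$ is the modulus. Put $$P_{\mathbf c}(x)=x^5+\tfrac32c_2x^2+27c_1x-\tfrac{27}2c_1^2,\qquad Q_{\mathbf c}(x)=x^3+6c_1x+(27+3c_2),$$ $\Delta_1(\mathbf c)=-27\bigl(32c_1^3+9(9+c_2)^2\bigr)$ and $\Delta_2(\mathbf c)=9c_1^3(c_1^3+216)+6c_1^3c_2(c_2+36)+(c_2+9)(c_2+18)^3$. One has $\tfrac32\tau^2\tau'^2=P_{\mathbf c}(\tau)$. $\mathcal B_1$ is the set of $\mathbf c\in\mathbb R^2$ such that $P_{\mathbf c}$ has two non-real roots and three simple real roots $e_1<e_2<e_3$ and $\Delta_1(\mathbf c)>0$; for such $\mathbf c$ one has $c_1<0$ and $e_1<e_2<0<e_3$. A critical curve with modulus $\mathbf c$ is general if $\Delta_1(\mathbf c)\Delta_2(\mathbf c)\ne0$. It is of type $\mathcal B_1'$ if $\mathbf c\in\mathcal B_1$, its twist is nonconstant, and the image of its signature $s\mapsto(\tau,\sqrt{3/2}\,\tau\tau')$ is the compact connected component of the curve $y^2=P_{\mathbf c}(x)$; equivalently, the twist is nonconstant, periodic, with values filling $[e_1,e_2]$ (and then $\gamma$ is defined on $\mathbb R$). $\gamma\colon\mathbb R\to\mathcal S$ is closed if it is periodic. *)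

(* Defs.v *)
(* Stdlib reals with Coquelicot. *)
From Stdlib Require Import Reals List.
From Coquelicot Require Import Coquelicot.
Open Scope R_scope.

(** * Vectors and 3x3 complex matrices *)

Definition C3 : Type := (C * C * C)%type.

Definition x1 (v : C3) : C := fst (fst v).
Definition x2 (v : C3) : C := snd (fst v).
Definition x3 (v : C3) : C := snd v.

Definition zero3 : C3 := (RtoC 0, RtoC 0, RtoC 0).
Definition add3 (v w : C3) : C3 :=
  ((x1 v + x1 w)%C, (x2 v + x2 w)%C, (x3 v + x3 w)%C).
Definition scal3 (k : C) (v : C3) : C3 :=
  ((k * x1 v)%C, (k * x2 v)%C, (k * x3 v)%C).

(** A matrix is the triple of its columns. *)
Definition M3 : Type := (C3 * C3 * C3)%type.

Definition col1 (A : M3) : C3 := fst (fst A).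
Definition col2 (A : M3) : C3 := snd (fst A).
Definition col3 (A : M3) : C3 := snd A.

Definition mulmv (A : M3) (v : C3) : C3 :=
  add3 (add3 (scal3 (x1 v) (col1 A)) (scal3 (x2 v) (col2 A)))
       (scal3 (x3 v) (col3 A)).
Definition mulm (A B : M3) : M3 :=
  (mulmv A (col1 B), mulmv A (col2 B), mulmv A (col3 B)).
Definition scalm (k : C) (A : M3) : M3 :=
  (scal3 k (col1 A), scal3 k (col2 A), scal3 k (col3 A)).

(** Conjugate transpose: its columns are the conjugated rows. *)
Definition ctrans (A : M3) : M3 :=
  ((Cconj (x1 (col1 A)), Cconj (x1 (col2 A)), Cconj (x1 (col3 A))),
   (Cconj (x2 (col1 A)), Cconj (x2 (col2 A)), Cconj (x2 (col3 A))),
   (Cconj (x3 (col1 A)), Cconj (x3 (col2 A)), Cconj (x3 (col3 A)))).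

(** Determinant of the matrix with columns [u], [v], [w]. *)
Definition det3 (u v w : C3) : C :=
  (x1 u * (x2 v * x3 w - x3 v * x2 w)
   - x2 u * (x1 v * x3 w - x3 v * x1 w)
   + x3 u * (x1 v * x2 w - x2 v * x1 w))%C.

Definition dot (z w : C3) : C :=
  (Cconj (x1 z) * x1 w + Cconj (x2 z) * x2 w + Cconj (x3 z) * x3 w)%C.

(** The rows of [hmat] are (0, 0, i), (0, 1, 0), (-i, 0, 0). *)
Definition hmat : M3 :=
  ((RtoC 0, RtoC 0, (- Ci)%C), (RtoC 0, RtoC 1, RtoC 0), (Ci, RtoC 0, RtoC 0)).

Definition herm (z w : C3) : C := dot z (mulmv hmat w).

Definition inG (A : M3) : Prop :=
  det3 (col1 A) (col2 A) (col3 A) = RtoC 1 /\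
  mulm (ctrans A) (mulm hmat A) = hmat.

(** * The projective plane: points are complex lines through the origin *)

Record CP2 : Type := mkCP2 {
  line : C3 -> Prop;
  line_spanned : exists z : C3, z <> zero3 /\
    forall w : C3, line w <-> exists k : C, w = scal3 k z
}.

(** [p = [z]]. *)
Definition represents (z : C3) (p : CP2) : Prop := z <> zero3 /\ line p z.

(** * Smoothness and derivatives *)

Definition smooth (f : R -> R) : Prop :=
  forall (n : nat) (t : R), ex_derive_n f n t.

Definition smoothC (f : R -> C) : Prop :=
  smooth (fun t => Re (f t)) /\ smooth (fun t => Im (f t)).

Definition smooth3 (f : R -> C3) : Prop :=
  smoothC (fun t => x1 (f t)) /\ smoothC (fun t => x2 (f t)) /\
  smoothC (fun t => x3 (f t)).

Definition smoothM (F : R -> M3) : Prop :=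
  smooth3 (fun t => col1 (F t)) /\ smooth3 (fun t => col2 (F t)) /\
  smooth3 (fun t => col3 (F t)).

(** Derivatives in a real variable; meaningful for smooth functions, to which
    they are applied below. *)
Definition DC (f : R -> C) (t : R) : C :=
  (Derive (fun s => Re (f s)) t, Derive (fun s => Im (f s)) t).

Definition D3 (f : R -> C3) (t : R) : C3 :=
  (DC (fun s => x1 (f s)) t, DC (fun s => x2 (f s)) t,
   DC (fun s => x3 (f s)) t).

Definition DM (F : R -> M3) (t : R) : M3 :=
  (D3 (fun s => col1 (F s)) t, D3 (fun s => col2 (F s)) t,
   D3 (fun s => col3 (F s)) t).

(** [f] is of class C^n in two variables on the strip [|u| < eps]. *)
Fixpoint Cn_strip (n : nat) (eps : R) (f : R -> R -> R) : Prop :=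
  (forall u t, Rabs u < eps -> continuity_2d_pt f u t) /\
  match n with
  | O => True
  | S m =>
      (forall u t, Rabs u < eps ->
         ex_derive (fun x => f x t) u /\ ex_derive (fun y => f u y) t) /\
      Cn_strip m eps (fun u t => Derive (fun x => f x t) u) /\
      Cn_strip m eps (fun u t => Derive (fun y => f u y) t)
  end.

Definition smoothC_strip (eps : R) (f : R -> R -> C) : Prop :=
  forall n : nat, Cn_strip n eps (fun u t => Re (f u t)) /\
                  Cn_strip n eps (fun u t => Im (f u t)).

Definition smooth3_strip (eps : R) (f : R -> R -> C3) : Prop :=
  smoothC_strip eps (fun u t => x1 (f u t)) /\
  smoothC_strip eps (fun u t => x2 (f u t)) /\
  smoothC_strip eps (fun u t => x3 (f u t)).

(** * Transversal curves *)

(** The line bundle of lines over an interval (or over a strip, below) is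
    trivial, so a map into the null lines is smooth exactly when it has a
    smooth lift. *)
Definition is_lift (g : R -> CP2) (G : R -> C3) : Prop :=
  smooth3 G /\
  forall t : R, represents (G t) (g t) /\ herm (G t) (G t) = RtoC 0.

(** The value of the contact form on the velocity of the curve with lift [G];
    this number is real because [G] is null. *)
Definition zeta (G : R -> C3) (t : R) : C :=
  (- Ci * herm (G t) (D3 G t) / dot (G t) (G t))%C.

(** Positive transversality [zeta <> 0] makes the curve an immersion. *)
Definition generic_transversal (g : R -> CP2) : Prop :=
  exists G : R -> C3, is_lift g G /\
    (forall t : R, 0 < Re (zeta G t)) /\
    (forall t : R, det3 (G t) (D3 G t) (D3 (D3 G) t) <> RtoC 0).

Definition wilczynski_lift (g : R -> CP2) (G : R -> C3) : Prop :=
  is_lift g G /\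
  forall t : R, det3 (G t) (D3 G t) (D3 (D3 G) t) = RtoC (-1).

(** The density [a] of the infinitesimal strain [ds = a dt], read off the
    Wilczynski lift [G]. *)
Definition strain_density (G : R -> C3) (a : R -> R) : Prop :=
  forall t : R, 0 < a t /\ RtoC (a t) = (Ci / herm (G t) (D3 G t))%C.

Definition natural_parameter (g : R -> CP2) : Prop :=
  exists G : R -> C3, wilczynski_lift g G /\ strain_density G (fun _ => 1).

(** The rows are (i kappa, -i, tau), (0, -2 i kappa, 1), (1, 0, i kappa). *)
Definition Kmat (kappa tau : R) : M3 :=
  (((Ci * RtoC kappa)%C, RtoC 0, RtoC 1),
   ((- Ci)%C, (- RtoC 2 * Ci * RtoC kappa)%C, RtoC 0),
   (RtoC tau, RtoC 1, (Ci * RtoC kappa)%C)).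

(** Wilczynski frame, bending and twist in an arbitrary parameter [t], i.e.
    [F^-1 dF = K(kappa, tau) ds] with [ds = a dt].  If [G] is the Wilczynski
    lift with respect to [t], then [a G] is the one with respect to the natural
    parameter, and this is the first column of [F].  For [a = 1] one recovers
    [col1 F = G] and [F^-1 F' = K(kappa, tau)]. *)
Definition wilczynski_frame (g : R -> CP2) (a : R -> R) (F : R -> M3)
    (kappa tau : R -> R) : Prop :=
  (exists G : R -> C3, wilczynski_lift g G /\ strain_density G a /\
     forall t : R, col1 (F t) = scal3 (RtoC (a t)) (G t)) /\
  smoothM F /\ smooth kappa /\ smooth tau /\
  forall t : R, inG (F t) /\
    DM F t = mulm (F t) (scalm (RtoC (a t)) (Kmat (kappa t) (tau t))).

(** * The total CR twist and its critical curves *)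

(** [w] is the integral of [tau ds] along the arc of [g] over [[p, q]]. *)
Definition total_twist (g : R -> CP2) (p q w : R) : Prop :=
  exists (a : R -> R) (F : R -> M3) (kappa tau : R -> R),
    wilczynski_frame g a F kappa tau /\
    is_RInt (fun t => tau t * a t) p q w.

(** Variation of [g] through generic transversal curves, with parameter
    [|u| < eps] and support in the compact interval [[p, q]]. *)
Definition variation (g : R -> CP2) (eps p q : R) (V : R -> R -> CP2) : Prop :=
  0 < eps /\ p < q /\
  (exists G : R -> R -> C3, smooth3_strip eps G /\
     forall u t, Rabs u < eps ->
       represents (G u t) (V u t) /\ herm (G u t) (G u t) = RtoC 0) /\
  (forall u, Rabs u < eps -> generic_transversal (V u)) /\
  (forall t, V 0 t = g t) /\
  (forall u t, Rabs u < eps -> t < p \/ q < t -> V u t = g t).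

Definition critical (g : R -> CP2) : Prop :=
  generic_transversal g /\
  forall (eps p q : R) (V : R -> R -> CP2) (w : R -> R),
    variation g eps p q V ->
    (forall u, Rabs u < eps -> total_twist (V u) p q (w u)) ->
    is_derive w 0 0.

(** * Modulus *)

Definition Pc (c1 c2 x : R) : R :=
  x ^ 5 + 3 / 2 * c2 * x ^ 2 + 27 * c1 * x - 27 / 2 * c1 ^ 2.

(** The same polynomial on complex arguments. *)
Definition PcC (c1 c2 : R) (x : C) : C :=
  (x ^ 5 + RtoC (3 / 2 * c2) * x ^ 2 + RtoC (27 * c1) * x
   - RtoC (27 / 2 * c1 ^ 2))%C.

Definition Qc (c1 c2 x : R) : R := x ^ 3 + 6 * c1 * x + (27 + 3 * c2).

Definition Delta1 (c1 c2 : R) : R := - 27 * (32 * c1 ^ 3 + 9 * (9 + c2) ^ 2).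

Definition Delta2 (c1 c2 : R) : R :=
  9 * c1 ^ 3 * (c1 ^ 3 + 216) + 6 * c1 ^ 3 * c2 * (c2 + 36)
  + (c2 + 9) * (c2 + 18) ^ 3.

Definition has_modulus (kappa tau : R -> R) (c1 c2 : R) : Prop :=
  forall s : R,
    kappa s * tau s ^ 2 = c1 /\
    - 18 * kappa s * tau s + 9 * kappa s ^ 2 * tau s ^ 2
      - 2 / 3 * tau s ^ 3 + Derive tau s ^ 2 = c2.

Definition general (c1 c2 : R) : Prop := Delta1 c1 c2 * Delta2 c1 c2 <> 0.

Definition in_B1 (c1 c2 : R) : Prop :=
  (exists (e1 e2 e3 : R) (z1 z2 : C),
     e1 < e2 < e3 /\ Im z1 <> 0 /\ Im z2 <> 0 /\ z1 <> z2 /\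
     forall x : C,
       PcC c1 c2 x = ((x - RtoC e1) * (x - RtoC e2) * (x - RtoC e3)
                      * (x - z1) * (x - z2))%C) /\
  0 < Delta1 c1 c2.

(** * Compact connected components *)

Definition connected_set {T : UniformSpace} (A : T -> Prop) : Prop :=
  forall U V : T -> Prop, open U -> open V ->
    (forall x, A x -> U x \/ V x) ->
    (exists x, A x /\ U x) -> (exists x, A x /\ V x) ->
    exists x, A x /\ U x /\ V x.

Definition compact_set {T : UniformSpace} (A : T -> Prop) : Prop :=
  forall F : (T -> Prop) -> Prop,
    (forall U, F U -> open U) ->
    (forall x, A x -> exists U, F U /\ U x) ->
    exists l : list (T -> Prop),
      (forall U, In U l -> F U) /\
      forall x, A x -> exists U, In U l /\ U x.

Definition connected_component_of {T : UniformSpace} (A E : T -> Prop) : Prop :=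
  (exists x, A x) /\ (forall x, A x -> E x) /\ connected_set A /\
  forall B : T -> Prop, connected_set B ->
    (forall x, A x -> B x) -> (forall x, B x -> E x) ->
    forall x, B x -> A x.

Definition signature_image (tau : R -> R) : R * R -> Prop :=
  fun m => exists s : R, m = (tau s, sqrt (3 / 2) * tau s * Derive tau s).

Definition type_B1' (tau : R -> R) (c1 c2 : R) : Prop :=
  in_B1 c1 c2 /\
  (exists s1 s2 : R, tau s1 <> tau s2) /\
  connected_component_of (signature_image tau)
    (fun m : R * R => snd m ^ 2 = Pc c1 c2 (fst m)) /\
  compact_set (signature_image tau).

(** * Closed curves and the complete hyperelliptic integrals *)

Definition closed_curve (g : R -> CP2) : Prop :=
  exists T : R, 0 < T /\ forall t : R, g (t + T) = g t.

Definition integrand (c1 c2 l x : R) : R :=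
  sqrt 3 * (3 * c1 * l - (4 * c1 + l ^ 2) * x ^ 2 + 3 * x ^ 3)
  / (sqrt 2 * x * (3 * l - x ^ 2) * sqrt (Pc c1 c2 x)).

(** The integral from [e2] down to [e1], improper at both endpoints, where
    [Pc] vanishes. *)
Definition frakP (c1 c2 e1 e2 l : R) : R :=
  / PI * RInt_gen (integrand c1 c2 l) (at_left e2) (at_right e1).

Definition is_rational (x : R) : Prop := exists r : QArith_base.Q, x = Q2R r.

(* Main.v *)
From Stdlib Require Import Nsatz.
Require Import Defs.
From Stdlib Require Import Reals Lra Lia Classical ZArith List
  FunctionalExtensionality PropExtensionality.
From Coquelicot Require Import Coquelicot.
Open Scope R_scope.

(** The Euler-Lagrange equations make [F L F^-1] constant for a matrix
    [L(kappa, tau, tau')] whose eigenvalues are [- i l_j / 3].  Hence for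
    constant row vectors [r_j] the row [r_j F] is a multiple of an explicit
    eigenrow of [L], namely [exp (i th_j) / sqrt |tau^2 - 3 l_j|] times it, where
    [th_j'] is a rational function of [tau].  By the energy equation the twist
    oscillates between [e1] and [e2] with some period [w], and substituting
    [x = tau s] shows that [th_j] advances by [2 PI frakP_j] during [w].  So
    [F (s + w) = M F (s)] with [M] of eigenvalues [exp (2 i PI frakP_j)], and
    the curve closes up exactly when a power of [M] is a scalar, necessarily a
    cube root of unity. *)

(** * The quintic [P] *)

(** The scalar factor [f] of the eigenrow [u] is forced by the first column of [y' = y K], which
    reads [f'/f = i kappa + (u3 - u1') / u1]. Its real part [- tau tau' / (tau^2 - 3 l)] integrates
    to the inverse square root, and its imaginary part is [th']. Dividing by [u1] is legitimate
    because [tau^2 - 3 l] has no zero on [[e1, e2]]; this is the role of [Delta2 <> 0]. The energy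
    equation alone does not force oscillation: a solution of [tau'^2 = v tau] may rest at a simple
    zero of [v] for any length of time. Hence everything runs through [tau'' = phi tau], whose
    solutions are unique. Uniqueness gives reflection symmetry about each turning time, and the
    period and the equality of the two half-period integrals follow from it. For the converse
    direction a closing time must first be related to [w]. Since [|r_j F_1|^2 = |tau^2 - 3 l_j|], a
    projective return of [F_1] makes the twist return, so the closing time is a multiple of [w]. The
    cube root of unity comes from [det F = 1]. *)

Lemma in_B1_c1_neg c1 c2 : in_B1 c1 c2 -> c1 < 0.
Proof.
  intros [_ H]; unfold Delta1 in H.
  destruct (Rlt_or_le c1 0) as [|h]; [assumption|exfalso].
  assert (0 <= c1 ^ 3) by (apply pow_le; lra).
  assert (0 <= (9 + c2) ^ 2) by apply pow2_ge_0. lra.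
Qed.

Lemma C_factor_real (e1 e2 e3 x : R) (z1 z2 : C) :
  ((RtoC x - RtoC e1) * (RtoC x - RtoC e2) * (RtoC x - RtoC e3)
    * (RtoC x - z1) * (RtoC x - z2))%C
  = (RtoC ((x - e1) * (x - e2) * (x - e3)) * ((RtoC x - z1) * (RtoC x - z2)))%C.
Proof. rewrite !RtoC_mult, !RtoC_minus; ring. Qed.

Lemma PcC_RtoC c1 c2 x : PcC c1 c2 (RtoC x) = RtoC (Pc c1 c2 x).
Proof.
  unfold PcC, Pc.
  rewrite RtoC_minus, !RtoC_plus, !RtoC_mult, !RtoC_pow. reflexivity.
Qed.

(** At a real [x] beyond the largest root the imaginary part of the complex factorization must
    vanish. That is a linear condition in [x], and two values of [x] show that the nonreal roots are
    conjugate. The real roots named in [in_B1] are then matched with the given ones by their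
    order. *)
Lemma in_B1_real_factor c1 c2 e1 e2 e3 :
  in_B1 c1 c2 -> e1 < e2 < e3 ->
  Pc c1 c2 e1 = 0 -> Pc c1 c2 e2 = 0 -> Pc c1 c2 e3 = 0 ->
  exists a b : R, b <> 0 /\
    forall x, Pc c1 c2 x
      = (x - e1) * (x - e2) * (x - e3) * ((x - a) ^ 2 + b ^ 2).
Proof.
  intros [[f1 [f2 [f3 [z1 [z2 [[hf1 hf2] [hz1 [hz2 [_ H]]]]]]]]] _] [he1 he2]
    p1 p2 p3.
  destruct z1 as [a1 b1], z2 as [a2 b2]; simpl in hz1, hz2.
  assert (HR : forall x,
    Pc c1 c2 x = (x - f1) * (x - f2) * (x - f3)
                   * ((x - a1) * (x - a2) - b1 * b2)
    /\ 0 = (x - f1) * (x - f2) * (x - f3)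
                   * (- (x - a1) * b2 - b1 * (x - a2))).
  { intros x. specialize (H (RtoC x)).
    rewrite PcC_RtoC, C_factor_real in H.
    apply (f_equal (fun z => (Re z, Im z))) in H; simpl in H.
    injection H as H1 H2. split; [rewrite H1; ring | etransitivity; [exact H2 | ring]]. }
  assert (Hlin : forall x, f3 < x -> - (x - a1) * b2 - b1 * (x - a2) = 0).
  { intros x hx. destruct (HR x) as [_ h].
    destruct (Rmult_integral _ _ (eq_sym h)) as [h0|]; [exfalso|assumption].
    assert (0 < (x - f1) * (x - f2) * (x - f3))
      by (repeat apply Rmult_lt_0_compat; lra). lra. }
  assert (h1 := Hlin (f3 + 1) ltac:(lra)).
  assert (h2 := Hlin (f3 + 2) ltac:(lra)).
  assert (hb : b2 = - b1) by lra. subst b2.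
  assert (ha : a2 = a1).
  { apply (Rmult_eq_reg_l b1); [lra|assumption]. }
  subst a2.
  assert (hb2 : 0 < b1 ^ 2) by (apply pow2_gt_0; assumption).
  assert (Hroot : forall e, Pc c1 c2 e = 0 -> e = f1 \/ e = f2 \/ e = f3).
  { intros e he. destruct (HR e) as [h _]. rewrite he in h.
    destruct (Rmult_integral _ _ (eq_sym h)) as [h0|h0].
    - destruct (Rmult_integral _ _ h0) as [h3|h3]; [|lra].
      destruct (Rmult_integral _ _ h3); lra.
    - exfalso. assert (0 <= (e - a1) ^ 2) by apply pow2_ge_0. nra. }
  destruct (Hroot _ p1) as [?|[?|?]], (Hroot _ p2) as [?|[?|?]],
    (Hroot _ p3) as [?|[?|?]]; try lra.
  exists a1, b1; split; [assumption|].
  intros x. destruct (HR x) as [-> _]. subst. ring.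
Qed.

(** The combination [x^2 P(y) - y^2 P(x)] eliminates [c2], and for [c1 < 0 < x < y] each remaining
    term is positive. *)
Lemma Pc_pos_root_unique c1 c2 x y :
  c1 < 0 -> 0 < x -> x < y -> Pc c1 c2 x = 0 -> Pc c1 c2 y = 0 -> False.
Proof.
  intros hc hx hxy px py.
  assert (E : 0 = x ^ 2 * y ^ 2 * (y ^ 3 - x ^ 3) + (- c1) * 27 * (x * y * (y - x))
                  + 27 / 2 * (c1 ^ 2 * ((y - x) * (y + x)))).
  { transitivity (x ^ 2 * Pc c1 c2 y - y ^ 2 * Pc c1 c2 x);
      [rewrite px, py; ring | unfold Pc; field]. }
  assert (0 < x ^ 2 * y ^ 2 * (y ^ 3 - x ^ 3)).
  { replace (y ^ 3 - x ^ 3) with ((y - x) * (y ^ 2 + x * y + x ^ 2)) by ring.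
    repeat apply Rmult_lt_0_compat; try apply pow_lt; try lra.
    assert (0 < x * y) by nra. nra. }
  assert (0 < (- c1) * 27 * (x * y * (y - x)))
    by (repeat apply Rmult_lt_0_compat; lra).
  assert (0 < c1 ^ 2 * ((y - x) * (y + x))).
  { apply Rmult_lt_0_compat; [apply pow2_gt_0; lra|].
    apply Rmult_lt_0_compat; lra. }
  lra.
Qed.

(** [P(0) = - 27/2 c1^2 < 0] gives [e1 e2 e3 > 0], so the number of negative roots is even. At most
    one root is positive, which leaves exactly two negative ones. *)
Lemma Pc_roots_sign c1 c2 e1 e2 e3 :
  in_B1 c1 c2 -> e1 < e2 < e3 ->
  Pc c1 c2 e1 = 0 -> Pc c1 c2 e2 = 0 -> Pc c1 c2 e3 = 0 ->
  e2 < 0 < e3.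
Proof.
  intros HB he p1 p2 p3.
  assert (hc := in_B1_c1_neg _ _ HB).
  destruct (in_B1_real_factor _ _ _ _ _ HB he p1 p2 p3) as [a [b [hb Hf]]].
  assert (P0 : Pc c1 c2 0 < 0).
  { unfold Pc. assert (0 < c1 ^ 2) by (apply pow2_gt_0; lra). lra. }
  assert (hq : 0 < (0 - a) ^ 2 + b ^ 2).
  { assert (0 < b ^ 2) by (apply pow2_gt_0; assumption).
    assert (0 <= (0 - a) ^ 2) by apply pow2_ge_0. lra. }
  rewrite Hf in P0.
  assert (h3 : 0 < e1 * e2 * e3).
  { apply Rnot_le_lt; intros h.
    assert (0 <= - (e1 * e2 * e3) * ((0 - a) ^ 2 + b ^ 2))
      by (apply Rmult_le_pos; lra). lra. }
  assert (h2 : e2 <= 0).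
  { destruct (Rle_or_lt e2 0); [assumption|exfalso].
    exact (Pc_pos_root_unique c1 c2 e2 e3 hc ltac:(lra) ltac:(lra) p2 p3). }
  assert (e2 <> 0) by (intros ->; lra).
  assert (0 < e1 * e2) by nra.
  split; [lra|]. nra.
Qed.

(* With [kappa = c1 / tau^2], criticality and the modulus [c2] read
   [tau'' = phi c1 tau] and [tau'^2 = speed2 c1 c2 tau]. *)
Definition phi (c1 x : R) : R := x ^ 2 - 9 * c1 / x ^ 2 + 9 * c1 ^ 2 / x ^ 3.
Definition speed2 (c1 c2 x : R) : R :=
  c2 + 18 * c1 / x - 9 * c1 ^ 2 / x ^ 2 + 2 / 3 * x ^ 3.

Lemma Pc_speed2 c1 c2 x : x <> 0 -> Pc c1 c2 x = 3 / 2 * x ^ 2 * speed2 c1 c2 x.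
Proof. intros; unfold Pc, speed2; field; assumption. Qed.

(** With the derivative in this form, [P' = 3 x^2 phi] at a root, so simplicity of the root
    translates into [phi <> 0]. *)
Lemma is_derive_Pc c1 c2 x : x <> 0 ->
  is_derive (Pc c1 c2) x (3 * x ^ 2 * phi c1 x + 2 / x * Pc c1 c2 x).
Proof.
  intros hx. unfold Pc, phi. auto_derive; [exact I|]. simpl. field; assumption.
Qed.

Section Roots.
Variables (c1 c2 e1 e2 e3 a b : R).
Hypotheses (he1 : e1 < e2) (he2 : e2 < 0) (he3 : 0 < e3) (hb : b <> 0).
Hypothesis Hf : forall x, Pc c1 c2 x
      = (x - e1) * (x - e2) * (x - e3) * ((x - a) ^ 2 + b ^ 2).

Lemma Pc_quadratic_factor_pos x : 0 < (x - a) ^ 2 + b ^ 2.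
Proof.
  assert (0 < b ^ 2) by (apply pow2_gt_0; assumption).
  assert (0 <= (x - a) ^ 2) by apply pow2_ge_0. lra.
Qed.

Lemma Pc_nonneg_range x : 0 <= Pc c1 c2 x -> e1 <= x <= e2 \/ e3 <= x.
Proof.
  intros h. rewrite Hf in h.
  assert (q := Pc_quadratic_factor_pos x).
  assert (h' : 0 <= (x - e1) * (x - e2) * (x - e3)).
  { apply Rnot_lt_le; intros n.
    assert (0 < - ((x - e1) * (x - e2) * (x - e3)) * ((x - a) ^ 2 + b ^ 2))
      by (apply Rmult_lt_0_compat; lra). lra. }
  destruct (Rle_or_lt e3 x) as [|n3]; [right; assumption|left].
  assert (h2 : (x - e1) * (x - e2) <= 0) by nra.
  nra.
Qed.

Lemma Pc_pos_between x : e1 < x < e2 -> 0 < Pc c1 c2 x.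
Proof.
  intros h. rewrite Hf.
  replace ((x - e1) * (x - e2) * (x - e3)) with ((x - e1) * (e2 - x) * (e3 - x)) by ring.
  repeat apply Rmult_lt_0_compat; try lra. apply Pc_quadratic_factor_pos.
Qed.

Lemma Pc_root_cases x : Pc c1 c2 x = 0 -> x = e1 \/ x = e2 \/ x = e3.
Proof.
  intros h. rewrite Hf in h. assert (q := Pc_quadratic_factor_pos x).
  destruct (Rmult_integral _ _ h) as [h0|]; [|lra].
  destruct (Rmult_integral _ _ h0) as [h3|h3]; [|lra].
  destruct (Rmult_integral _ _ h3); lra.
Qed.

(** The roots are simple. Dynamically, no turning value is an equilibrium of [x'' = phi x], so it
    cannot be a limit that is approached forever. *)
Lemma phi_root_neq0 x : Pc c1 c2 x = 0 -> phi c1 x <> 0.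
Proof.
  intros h0 hphi.
  assert (hx := Pc_root_cases x h0).
  assert (q := Pc_quadratic_factor_pos x).
  assert (hx0 : x <> 0) by (destruct hx as [->|[->| ->]]; lra).
  assert (D1 := is_derive_Pc c1 c2 x hx0).
  rewrite h0, hphi in D1.
  set (Q := (x - a) ^ 2 + b ^ 2) in q.
  assert (D2 : is_derive (Pc c1 c2) x
     (((x - e2) * (x - e3) + (x - e1) * (x - e3) + (x - e1) * (x - e2)) * Q
      + (x - e1) * (x - e2) * (x - e3) * (2 * (x - a)))).
  { apply (is_derive_ext
      (fun x => (x - e1) * (x - e2) * (x - e3) * ((x - a) ^ 2 + b ^ 2))).
    - intros; symmetry; apply Hf.
    - auto_derive; [exact I|]. unfold Q; simpl; ring. }
  assert (E := is_derive_unique _ _ _ D1).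
  rewrite (is_derive_unique _ _ _ D2) in E.
  assert (E' : ((x - e2) * (x - e3) + (x - e1) * (x - e3) + (x - e1) * (x - e2)) = 0).
  { destruct (Req_dec ((x - e2) * (x - e3) + (x - e1) * (x - e3)
                       + (x - e1) * (x - e2)) 0) as [|n]; [assumption|exfalso].
    assert (hz : (x - e1) * (x - e2) * (x - e3) = 0)
      by (destruct hx as [->|[->| ->]]; ring).
    rewrite hz in E. apply n. apply (Rmult_eq_reg_r Q); lra. }
  destruct hx as [->|[->| ->]]; nra.
Qed.
End Roots.

(* On the zero set of [x^2 - 3 l] this exhibits [- 6 P] as a square: there
   [P] and the square must both vanish, i.e. the resultant [Delta2] does. *)
Lemma Pc_sos_identity c1 c2 l x : Qc c1 c2 l = 0 ->
  6 * Pc c1 c2 x + (9 * (c1 - x) + x ^ 2 * l) ^ 2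
  = x ^ 2 * (x ^ 2 - 3 * l) * (l ^ 2 + 6 * x).
Proof.
  unfold Qc, Pc; intros h.
  assert (E : c2 = - 9 - (l ^ 3 + 6 * c1 * l) / 3) by lra.
  rewrite E. field.
Qed.

Lemma eigenform_neq0 c1 c2 l x : Qc c1 c2 l = 0 -> Delta2 c1 c2 <> 0 ->
  x <> 0 -> 0 <= Pc c1 c2 x -> x ^ 2 - 3 * l <> 0.
Proof.
  intros hq hD hx hP h0. apply hD.
  assert (S := Pc_sos_identity c1 c2 l x hq). rewrite h0 in S.
  assert (h2 := pow2_ge_0 (9 * (c1 - x) + x ^ 2 * l)).
  assert (P0 : Pc c1 c2 x = 0) by lra.
  assert (hl : l = x ^ 2 / 3) by lra.
  assert (E : 9 * (c1 - x) + x ^ 2 * l = 0) by (apply Rsqr_0_uniq; unfold Rsqr; lra).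
  (* Together with [l = x^2 / 3] this makes [c1] and [c2] polynomials in [x] alone: a parametrized
     arc on which [Delta2] vanishes identically. *)
  assert (Ec : c1 = x - x ^ 4 / 27) by (rewrite hl in E; lra).
  assert (Ec2 : c2 = - 9 - (l ^ 3 + 6 * c1 * l) / 3) by (unfold Qc in hq; lra).
  unfold Delta2. rewrite Ec2, hl, Ec. field.
Qed.

(** * Oscillations of [x'' = ph x] *)

Ltac ex_derive_hyp :=
  repeat split;
  match goal with
  | H : forall s, is_derive ?f s (@?g s) |- ex_derive (fun x => ?f x) ?u =>
      exists (g u); exact (H u)
  end.

Lemma is_derive_continuity_pt f x l : is_derive f x l -> continuity_pt f x.
Proof.
  intros h. apply continuity_pt_filterlim.
  apply (ex_derive_continuous f x). exists l; exact h.
Qed.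

Lemma continuity_pt_pos_nbhd (f : R -> R) a : continuity_pt f a -> 0 < f a ->
  exists d, 0 < d /\ forall y, Rabs (y - a) < d -> 0 < f y.
Proof.
  intros hc hp.
  destruct (hc (f a) hp) as [d [hd H]].
  exists d; split; [assumption|]. intros y hy.
  destruct (Req_dec y a) as [->|hn]; [assumption|].
  assert (h : Rabs (f y - f a) < f a).
  { apply H. split; [split; [exact I | auto] | exact hy]. }
  apply Rabs_def2 in h; lra.
Qed.

Lemma derive_ge_unbounded (f f' : R -> R) S d M : 0 < d ->
  (forall s, S <= s -> is_derive f s (f' s)) ->
  (forall s, S <= s -> d <= f' s) ->
  exists s, S <= s /\ M < f s.
Proof.
  intros hd hf hf'.
  set (K := Rmax 0 (M - f S) + 1).
  assert (hK : 0 < K) by (unfold K; pose proof (Rmax_l 0 (M - f S)); lra).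
  assert (hKd : 0 < K / d) by (apply Rdiv_lt_0_compat; assumption).
  exists (S + K / d); split; [lra|].
  destruct (MVT_gen f S (S + K / d) f') as [c [hc E]].
  - intros x; rewrite Rmin_left, Rmax_right by lra; intros; apply hf; lra.
  - intros x; rewrite Rmin_left, Rmax_right by lra; intros.
    apply is_derive_continuity_pt with (f' x), hf; lra.
  - rewrite Rmin_left, Rmax_right in hc by lra.
    assert (h := hf' c ltac:(lra)).
    assert (d * (K / d) <= f' c * (K / d)) by (apply Rmult_le_compat_r; lra).
    replace (d * (K / d)) with K in H by (field; apply Rgt_not_eq, hd).
    replace (S + K / d - S) with (K / d) in E by ring.
    assert (M - f S < K) by (unfold K; pose proof (Rmax_r 0 (M - f S)); lra). lra.
Qed.

Lemma first_zero (f : R -> R) a :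
  continuity f -> 0 < f a ->
  (forall s, a <= s -> 0 < f s) \/
  (exists b, a < b /\ f b = 0 /\ forall s, a <= s < b -> 0 < f s).
Proof.
  intros hc ha.
  set (E := fun t => a <= t /\ forall y, a <= y <= t -> 0 < f y).
  destruct (classic (bound E)) as [hb|hb].
  - right. destruct (completeness E hb) as [b [ub lub]].
    { exists a; split; [lra|]. intros y hy; replace y with a by lra; assumption. }
    assert (hpos : forall s, a <= s < b -> 0 < f s).
    { intros s hs. apply NNPP; intros hn.
      assert (b <= s); [|lra]. apply lub. intros t [ht1 ht2].
      apply Rnot_lt_le; intros hst. apply hn, ht2; lra. }
    assert (hab : a <= b).
    { apply ub; split; [lra|]. intros y hy; replace y with a by lra; assumption. }
    destruct (Rtotal_order (f b) 0) as [h|[h|h]].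
    + exfalso. destruct (continuity_pt_pos_nbhd (fun x => - f x) b) as [d [hd H]].
      { apply continuity_pt_opp, hc. } { lra. }
      destruct (Req_dec a b) as [->|hn]; [lra|].
      set (y := Rmax a (b - d / 2)).
      assert (a <= y) by apply Rmax_l.
      assert (b - d / 2 <= y) by apply Rmax_r.
      assert (y < b) by (unfold y; apply Rmax_lub_lt; lra).
      assert (h1 := hpos y ltac:(lra)).
      assert (h2 := H y). cbv beta in h2.
      assert (h3 : Rabs (y - b) < d) by (apply Rabs_def1; lra).
      specialize (h2 h3). lra.
    + exists b; repeat split; try assumption.
      destruct hab as [|hab]; [assumption|subst; lra].
    + exfalso. destruct (continuity_pt_pos_nbhd f b (hc b) h) as [d [hd H]].
      assert (b + d / 2 <= b); [|lra]. apply ub. split; [lra|].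
      intros y hy. destruct (Rlt_or_le y b); [apply hpos; lra|].
      apply H, Rabs_def1; lra.
  - left. intros s hs. apply NNPP; intros hn. apply hb.
    exists s. intros t [_ ht]. apply Rnot_lt_le; intros hst. apply hn, ht; lra.
Qed.

Lemma derive_pos_increasing (f f' : R -> R) a b :
  a < b -> (forall s, is_derive f s (f' s)) ->
  (forall s, a < s < b -> 0 < f' s) -> f a < f b.
Proof.
  intros hab hf hp.
  destruct (MVT_cor2 f f' a b hab) as [c [E hc]].
  - intros c _. apply is_derive_Reals, hf.
  - assert (0 < f' c * (b - a)) by (apply Rmult_lt_0_compat; [apply hp|]; lra). lra.
Qed.

(* If [x] kept increasing it would converge to some [l] with [v l = 0] (else
   [x] is unbounded), and then [x'' = ph x] would stay away from [0]. *)
Lemma first_turning_point (x x' v ph : R -> R) s1 M :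
  (forall s, is_derive x s (x' s)) ->
  (forall s, is_derive x' s (ph (x s))) ->
  (forall s, x' s ^ 2 = v (x s)) ->
  (forall s, x s <= M) ->
  (forall y, x s1 <= y <= M ->
     continuity_pt v y /\ continuity_pt ph y /\ (v y = 0 -> ph y <> 0)) ->
  0 < x' s1 ->
  exists s2, s1 < s2 /\ x' s2 = 0 /\ forall s, s1 <= s < s2 -> 0 < x' s.
Proof.
  intros dx dx' en hM hv h1.
  destruct (first_zero x' s1) as [hpos|]; [|assumption| |assumption].
  { intros s; exact (is_derive_continuity_pt _ _ _ (dx' s)). }
  exfalso.
  destruct (completeness (fun y => exists s, s1 <= s /\ y = x s)) as [l [ub lub]].
  { exists M; intros y [s [_ ->]]; apply hM. }
  { exists (x s1), s1; split; [lra|reflexivity]. }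
  assert (hl : x s1 <= l <= M).
  { split; [apply ub; exists s1; split; [lra|reflexivity]|].
    apply lub; intros y [s [_ ->]]; apply hM. }
  assert (mono : forall s t, s1 <= s -> s <= t -> x s <= x t).
  { intros s t hs [hst| ->]; [|lra]. left.
    apply derive_pos_increasing with x'; [assumption|exact dx|].
    intros u hu; apply hpos; lra. }
  (* Since [x] increases to [l], any strict inequality between continuous functions at [l]
     eventually holds along [x]. *)
  assert (ev : forall h, continuity_pt h l -> 0 < h l ->
            exists S, s1 <= S /\ forall s, S <= s -> 0 < h (x s)).
  { intros h hc hp.
    destruct (continuity_pt_pos_nbhd h l hc hp) as [d [hd H]].
    assert (exists S, s1 <= S /\ l - d < x S) as [S [hS1 hS2]].
    { apply NNPP; intros hn. assert (l <= l - d); [|lra].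
      apply lub. intros y [s [hs ->]]. apply Rnot_lt_le; intros hlt.
      apply hn; exists s; split; assumption. }
    exists S; split; [assumption|]. intros s hs. apply H.
    assert (x S <= x s) by (apply mono; lra).
    assert (x s <= l) by (apply ub; exists s; split; [lra|reflexivity]).
    apply Rabs_def1; lra. }
  destruct (hv l hl) as [cv [cph hz]].
  assert (cc : forall c, continuity_pt (fun _ => c) l)
    by (intros c; apply continuity_pt_const; intros ? ?; reflexivity).
  destruct (Rtotal_order (v l) 0) as [h|[h|h]].
  - destruct (ev (fun y => - v y)) as [S [_ H]];
      [apply continuity_pt_opp, cv|lra|].
    specialize (H S (Rle_refl S)). cbv beta in H. rewrite <- en in H.
    pose proof (pow2_ge_0 (x' S)). lra.
  - destruct (Rtotal_order (ph l) 0) as [k|[k|k]].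
    + destruct (ev (fun y => ph l / 2 - ph y)) as [S [hS H]];
        [apply continuity_pt_minus; [apply cc|apply cph]|lra|].
      destruct (derive_ge_unbounded (fun s => - x' s) (fun s => - ph (x s)) S
                  (- ph l / 2) 0) as [s [hs1 hs2]].
      * lra.
      * intros s _. apply (is_derive_opp x' s (ph (x s))), dx'.
      * intros s hs; specialize (H s hs); cbv beta in H; lra.
      * cbv beta in hs2. specialize (hpos s ltac:(lra)). lra.
    + apply (hz h k).
    (* Here [x'] would grow beyond [1], whereas [x'^2 = v x] is eventually below [1]. *)
    + destruct (ev (fun y => ph y - ph l / 2)) as [S [hS H]];
        [apply continuity_pt_minus; [apply cph|apply cc]|lra|].
      destruct (ev (fun y => 1 - v y)) as [S' [hS' H']];
        [apply continuity_pt_minus; [apply cc|apply cv]|lra|].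
      destruct (derive_ge_unbounded x' (fun s => ph (x s)) (Rmax S S')
                  (ph l / 2) 1) as [s [hs1 hs2]].
      * lra.
      * intros s _; apply dx'.
      * intros s hs. pose proof (Rmax_l S S').
        specialize (H s ltac:(lra)); cbv beta in H; lra.
      * pose proof (Rmax_r S S').
        specialize (H' s ltac:(lra)); cbv beta in H'. rewrite <- en in H'. nra.
  - destruct (ev (fun y => v y - v l / 2)) as [S [hS H]];
      [apply continuity_pt_minus; [apply cv|apply cc]|lra|].
    destruct (derive_ge_unbounded x x' S (sqrt (v l / 2)) M) as [s [hs1 hs2]].
    + apply sqrt_lt_R0; lra.
    + intros s _; apply dx.
    + intros s hs. specialize (H s hs); cbv beta in H. rewrite <- en in H.
      rewrite <- (sqrt_pow2 (x' s)) by (left; apply hpos; lra).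
      apply sqrt_le_1_alt; lra.
    + specialize (hM s); lra.
Qed.

Lemma C1_lipschitz (f f' : R -> R) lo hi : lo <= hi ->
  (forall x, lo <= x <= hi -> is_derive f x (f' x)) ->
  (forall x, lo <= x <= hi -> continuity_pt f' x) ->
  exists L, 0 <= L /\ forall x y, lo <= x <= hi -> lo <= y <= hi ->
    Rabs (f x - f y) <= L * Rabs (x - y).
Proof.
  intros hlh df cf.
  destruct (continuity_ab_maj (fun x => Rabs (f' x)) lo hi hlh) as [m [hm _]].
  { intros c hc. apply (continuity_pt_comp f' Rabs); [apply cf, hc|apply Rcontinuity_abs]. }
  exists (Rabs (f' m)); split; [apply Rabs_pos|].
  intros x y hx hy.
  assert (Rmin y x = y \/ Rmin y x = x) by (unfold Rmin; destruct Rle_dec; auto).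
  assert (Rmax y x = y \/ Rmax y x = x) by (unfold Rmax; destruct Rle_dec; auto).
  destruct (MVT_gen f y x f') as [c [hc E]].
  - intros z hz; apply df; lra.
  - intros z hz; apply is_derive_continuity_pt with (f' z), df; lra.
  - rewrite E, Rabs_mult. apply Rmult_le_compat_r; [apply Rabs_pos|].
    apply hm; lra.
Qed.

(* Uniqueness for [x'' = ph x], applied to [x (c + t)] and [x (c - t)]:
   the energy [E = a^2 + b^2] of the difference satisfies [E' <= (1 + L) E]. *)
Lemma turning_point_reflection (x x' ph : R -> R) lo hi L c :
  (forall s, is_derive x s (x' s)) ->
  (forall s, is_derive x' s (ph (x s))) ->
  (forall s, lo <= x s <= hi) ->
  0 <= L ->
  (forall u w, lo <= u <= hi -> lo <= w <= hi ->
     Rabs (ph u - ph w) <= L * Rabs (u - w)) ->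
  x' c = 0 ->
  forall t, x (c + t) = x (c - t).
Proof.
  intros dx dx' hb hL lip hc.
  assert (key : forall t, 0 < t -> x (c + t) = x (c - t)).
  { intros t ht.
    set (a := fun s => x (c + s) - x (c - s)).
    set (b := fun s => x' (c + s) + x' (c - s)).
    (* Here [b] is the derivative of [a]. The exponential is the Gronwall factor: it makes the
       damped energy nonincreasing, and the energy starts at [0] because [x' c = 0]. *)
    set (E := fun s => (a s ^ 2 + b s ^ 2) * exp (- ((1 + L) * s))).
    set (q := fun s => ph (x (c + s)) - ph (x (c - s))).
    set (E' := fun s => (2 * a s * b s + 2 * b s * q s
                 - (1 + L) * (a s ^ 2 + b s ^ 2)) * exp (- ((1 + L) * s))).
    assert (dE : forall s, is_derive E s (E' s)).
    { intros s. unfold E, E', a, b, q.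
      auto_derive.
      - ex_derive_hyp.
      - rewrite !(is_derive_unique _ _ _ (dx _)), !(is_derive_unique _ _ _ (dx' _)).
        unfold Rminus. ring. }
    assert (hE' : forall s, E' s <= 0).
    { intros s. unfold E'.
      assert (he := exp_pos (- ((1 + L) * s))).
      assert (hq : Rabs (q s) <= L * Rabs (a s)) by (apply lip; apply hb).
      assert (h1 : b s * q s <= L * (Rabs (a s) * Rabs (b s))).
      { apply Rle_trans with (Rabs (b s * q s)); [apply Rle_abs|].
        rewrite Rabs_mult. pose proof (Rabs_pos (b s)). nra. }
      assert (h2 : a s * b s <= Rabs (a s) * Rabs (b s))
        by (rewrite <- Rabs_mult; apply Rle_abs).
      assert (h3 : 2 * (Rabs (a s) * Rabs (b s)) <= a s ^ 2 + b s ^ 2).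
      { rewrite <- (pow2_abs (a s)), <- (pow2_abs (b s)).
        pose proof (pow2_ge_0 (Rabs (a s) - Rabs (b s))). nra. }
      assert (2 * a s * b s + 2 * b s * q s - (1 + L) * (a s ^ 2 + b s ^ 2) <= 0)
        by nra.
      nra. }
    assert (E0 : E 0 = 0).
    { unfold E, a, b. rewrite Rplus_0_r, Rminus_0_r, hc. ring. }
    destruct (MVT_cor2 E E' 0 t ht) as [s [Es hs]].
    { intros u _. apply is_derive_Reals, dE. }
    assert (hEt : E t <= 0) by (specialize (hE' s); nra).
    unfold E in hEt. assert (he := exp_pos (- ((1 + L) * t))).
    assert (h : a t ^ 2 + b t ^ 2 <= 0).
    { apply Rnot_lt_le; intros hn.
      assert (0 < (a t ^ 2 + b t ^ 2) * exp (- ((1 + L) * t)))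
        by (apply Rmult_lt_0_compat; assumption). lra. }
    pose proof (pow2_ge_0 (a t)). pose proof (pow2_ge_0 (b t)).
    assert (ha : a t = 0) by (apply Rsqr_0_uniq; unfold Rsqr; lra).
    unfold a in ha; lra. }
  intros t. destruct (Rtotal_order t 0) as [h|[->|h]].
  - specialize (key (- t) ltac:(lra)). unfold Rminus in *.
    rewrite Ropp_involutive in key. symmetry; exact key.
  - rewrite Rplus_0_r, Rminus_0_r; reflexivity.
  - apply key, h.
Qed.

(** * Periods of an oscillation and integrals over them *)

Lemma is_derive_zero_const (f : R -> R) :
  (forall s, is_derive f s 0) -> forall s t, f s = f t.
Proof.
  intros h s t. destruct (Rtotal_order s t) as [k|[->|k]].
  - apply eq_is_derive; [intros; apply h|assumption].
  - reflexivity.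
  - symmetry; apply eq_is_derive; [intros; apply h|assumption].
Qed.

Lemma quasi_periodic_IZR (f : R -> R) w d :
  (forall s, f (s + w) = f s + d) ->
  forall k s, f (s + IZR k * w) = f s + IZR k * d.
Proof.
  intros h k. induction k as [|k IH|k IH] using Z.peano_ind; intros s.
  - rewrite !Rmult_0_l, !Rplus_0_r; reflexivity.
  - rewrite <- Z.add_1_r, plus_IZR.
    replace (s + (IZR k + 1) * w) with (s + IZR k * w + w) by ring.
    rewrite h, IH; ring.
  - rewrite <- Z.sub_1_r, minus_IZR.
    specialize (h (s + (IZR k - 1) * w)).
    replace (s + (IZR k - 1) * w + w) with (s + IZR k * w) in h by ring.
    rewrite IH in h; lra.
Qed.

(** This will confine the closing times of the curve to multiples of the period. After reduction
    modulo the period, the rising half [(s0, s2]] contains no further minimum by monotonicity, and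
    reflection about [s2] carries the other half to it. *)
Lemma oscillation_min_times (x x' : R -> R) s0 s2 :
  s0 < s2 ->
  (forall s, is_derive x s (x' s)) ->
  (forall s, s0 < s < s2 -> 0 < x' s) ->
  (forall t, x (s2 + t) = x (s2 - t)) ->
  (forall s, x (s + 2 * (s2 - s0)) = x s) ->
  forall s, x s = x s0 -> exists k : Z, s = s0 + IZR k * (2 * (s2 - s0)).
Proof.
  intros hs dx hp refl per s E.
  set (w := 2 * (s2 - s0)) in *.
  assert (hw : 0 < w) by (unfold w; lra).
  destruct (base_Int_part ((s - s0) / w)) as [k1 k2].
  set (k := Int_part ((s - s0) / w)) in *.
  exists k.
  set (u := s - IZR k * w).
  assert (hu : s0 <= u < s0 + w).
  { assert (h : (s - s0) / w * w = s - s0) by (field; lra).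
    unfold u; split; nra. }
  assert (Eu : x u = x s0).
  { rewrite <- E. unfold u.
    assert (h := quasi_periodic_IZR x w 0).
    rewrite <- (Rplus_0_r (x (s - IZR k * w))).
    replace 0 with (IZR k * 0) by ring.
    rewrite <- h; [f_equal; ring|]. intros; rewrite per; ring. }
  assert (inc : forall r, s0 < r <= s2 -> x s0 < x r).
  { intros r hr. apply derive_pos_increasing with x'; [lra|exact dx|].
    intros; apply hp; lra. }
  destruct (Req_dec u s0) as [h|h]; [unfold u in h; lra|exfalso].
  destruct (Rle_or_lt u s2).
  - specialize (inc u ltac:(lra)); lra.
  - specialize (inc (2 * s2 - u) ltac:(unfold w in hu; lra)).
    specialize (refl (u - s2)).
    replace (s2 + (u - s2)) with u in refl by ring.
    replace (s2 - (u - s2)) with (2 * s2 - u) in refl by ring. lra.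
Qed.

(** The symmetry of [h] about [s2] makes [th (s2 + t) + th (s2 - t)] constant, so the two halves of
    a period contribute equally. This is the origin of the factor 2 in the phase advance. *)
Lemma primitive_over_period (th h : R -> R) s0 s2 :
  (forall s, is_derive th s (h s)) ->
  (forall t, h (s2 + t) = h (s2 - t)) ->
  (forall s, h (s + 2 * (s2 - s0)) = h s) ->
  forall s, th (s + 2 * (s2 - s0)) = th s + 2 * (th s2 - th s0).
Proof.
  intros dth refl per s.
  set (w := 2 * (s2 - s0)).
  assert (E1 : th (s + w) - th s = th (s0 + w) - th s0).
  { apply (is_derive_zero_const (fun s => th (s + w) - th s)).
    intros t. auto_derive.
    - repeat split; eexists; apply dth.
    - rewrite !(is_derive_unique _ _ _ (dth _)), per. ring. }
  assert (E2 : th (s2 + (s2 - s0)) + th (s2 - (s2 - s0)) = th (s2 + 0) + th (s2 - 0)).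
  { apply (is_derive_zero_const (fun t => th (s2 + t) + th (s2 - t))).
    intros t. auto_derive.
    - repeat split; eexists; apply dth.
    - rewrite !(is_derive_unique _ _ _ (dth _)), refl. unfold Rminus; ring. }
  replace (s2 + (s2 - s0)) with (s0 + w) in E2 by (unfold w; ring).
  replace (s2 - (s2 - s0)) with s0 in E2 by ring.
  rewrite Rplus_0_r, Rminus_0_r in E2. lra.
Qed.

(** [f] may be singular at both turning values, so the substitution is carried out strictly inside
    and the endpoints are reached through the continuity of [th]. The integral runs from the maximum
    down to the minimum, hence the minus sign in the derivative of [th]. *)
Lemma is_RInt_gen_substitution (f x x' th : R -> R) s0 s2 : s0 < s2 ->
  (forall s, is_derive x s (x' s)) ->
  (forall s, continuity_pt x' s) ->
  (forall s, s0 < s < s2 -> 0 < x' s) ->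
  (forall y, x s0 < y < x s2 -> continuity_pt f y) ->
  (forall s, continuity_pt th s) ->
  (forall s, s0 < s < s2 -> is_derive th s (- (x' s * f (x s)))) ->
  is_RInt_gen f (at_left (x s2)) (at_right (x s0)) (th s2 - th s0).
Proof.
  intros hs dx cx' hp cf cth dth.
  assert (inc : forall a b, s0 <= a -> a < b -> b <= s2 -> x a < x b).
  { intros a b ha hab hb. apply derive_pos_increasing with x'; [lra|exact dx|].
    intros; apply hp; lra. }
  assert (cx : continuity x).
  { intros s; exact (is_derive_continuity_pt _ _ _ (dx s)). }
  assert (key : forall a b, s0 < a < s2 -> s0 < b < s2 ->
            is_RInt f (x a) (x b) (th a - th b)).
  { intros a b ha hb.
    assert (hm : s0 < Rmin a b) by (apply Rmin_glb_lt; lra).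
    assert (hM : Rmax a b < s2) by (apply Rmax_lub_lt; lra).
    assert (xr : forall s, s0 < s < s2 -> x s0 < x s < x s2)
      by (intros s h; split; apply inc; lra).
    assert (I1 : is_RInt (fun y => scal (x' y) (f (x y))) a b (RInt f (x a) (x b))).
    { apply (is_RInt_comp (V := R_CompleteNormedModule) f x x').
      - intros y hy. apply continuity_pt_filterlim, cf, xr; lra.
      - intros y hy. split; [apply dx|apply continuity_pt_filterlim, cx']. }
    assert (I2 : is_RInt (fun y => scal (x' y) (f (x y))) a b (th a - th b)).
    { replace (th a - th b) with (minus ((fun s => - th s) b) ((fun s => - th s) a))
        by (unfold minus, plus, opp; simpl; ring).
      apply (is_RInt_derive (V := R_CompleteNormedModule) (fun s => - th s)).
      - intros y hy. unfold scal; simpl; unfold mult; simpl.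
        replace (x' y * f (x y)) with (- - (x' y * f (x y))) by ring.
        apply (is_derive_opp th), dth; lra.
      - intros y hy. apply continuity_pt_filterlim.
        unfold scal; simpl; unfold mult; simpl.
        apply (continuity_pt_mult x' (fun y => f (x y))); [apply cx'|].
        apply (continuity_pt_comp x f); [apply cx|apply cf, xr; lra]. }
    rewrite <- (is_RInt_unique _ _ _ _ I2), (is_RInt_unique _ _ _ _ I1).
    apply (RInt_correct (V := R_CompleteNormedModule) f).
    apply (ex_RInt_continuous (V := R_CompleteNormedModule) f).
    assert (x s0 < Rmin (x a) (x b)) by (apply Rmin_glb_lt; apply xr; assumption).
    assert (Rmax (x a) (x b) < x s2) by (apply Rmax_lub_lt; apply xr; assumption).
    intros z hz. apply continuity_pt_filterlim, cf; lra. }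
  intros P [eps HP].
  assert (he : 0 < eps / 2) by (apply is_pos_div_2).
  assert (nb : forall c, exists d, 0 < d /\
            forall a, Rabs (a - c) < d -> Rabs (th a - th c) < eps / 2).
  { intros c.
    destruct (cth c (eps / 2) he) as [d [hd H]].
    exists d; split; [assumption|]. intros a ha.
    destruct (Req_dec a c) as [->|n].
    - rewrite Rminus_diag, Rabs_R0; exact he.
    - apply H. split; [split; [exact I|auto]|exact ha]. }
  destruct (nb s2) as [d2 [hd2 H2]], (nb s0) as [d0 [hd0 H0]].
  (* [m0] and [m2] lie on their own sides of the midpoint and within the continuity radii of [th].
     The images under [x] of [(m2, s2)] and [(s0, m0)] serve as filter sets, and the intermediate
     value theorem pulls the limits of integration back to times. *)
  set (m2 := Rmax ((s0 + s2) / 2) (s2 - d2 / 2)).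
  set (m0 := Rmin ((s0 + s2) / 2) (s0 + d0 / 2)).
  assert (hm2 : (s0 + s2) / 2 <= m2) by apply Rmax_l.
  assert (hm2' : s2 - d2 / 2 <= m2) by apply Rmax_r.
  assert (hm2'' : m2 < s2) by (apply Rmax_lub_lt; lra).
  assert (hm0 : m0 <= (s0 + s2) / 2) by apply Rmin_l.
  assert (hm0' : m0 <= s0 + d0 / 2) by apply Rmin_r.
  assert (hm0'' : s0 < m0) by (apply Rmin_glb_lt; lra).
  assert (x2 : x m2 < x s2) by (apply inc; lra).
  assert (x0 : x s0 < x m0) by (apply inc; lra).
  apply Filter_prod with (Q := fun y => x m2 < y < x s2) (R := fun y => x s0 < y < x m0).
  - assert (hpos : 0 < x s2 - x m2) by lra.
    exists (mkposreal _ hpos). intros y hy hlt. split; [|exact hlt].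
    unfold ball in hy; simpl in hy; unfold AbsRing_ball, abs, minus, plus, opp in hy.
    simpl in hy. apply Rabs_def2 in hy; lra.
  - assert (hpos : 0 < x m0 - x s0) by lra.
    exists (mkposreal _ hpos). intros y hy hlt. split; [exact hlt|].
    unfold ball in hy; simpl in hy; unfold AbsRing_ball, abs, minus, plus, opp in hy.
    simpl in hy. apply Rabs_def2 in hy; lra.
  - intros u v hu hv. simpl.
    destruct (IVT_gen x m2 s2 u cx) as [a [ha Ea]].
    { rewrite Rmin_left, Rmax_right by lra; lra. }
    destruct (IVT_gen x s0 m0 v cx) as [b [hb Eb]].
    { rewrite Rmin_left, Rmax_right by lra; lra. }
    rewrite Rmin_left, Rmax_right in ha, hb by lra.
    assert (a <> s2) by (intros ->; lra).
    assert (b <> s0) by (intros ->; lra).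
    exists (th a - th b). split.
    + rewrite <- Ea, <- Eb. apply key; lra.
    + apply HP. unfold ball; simpl; unfold AbsRing_ball, abs, minus, plus, opp; simpl.
      assert (h2 := H2 a ltac:(apply Rabs_def1; lra)).
      assert (h0 := H0 b ltac:(apply Rabs_def1; lra)).
      apply Rabs_def2 in h2; apply Rabs_def2 in h0. apply Rabs_def1; lra.
Qed.

(** * Curves in [C] *)

Definition is_deriveC (f : R -> C) (t : R) (l : C) : Prop :=
  is_derive (fun s => Re (f s)) t (Re l) /\ is_derive (fun s => Im (f s)) t (Im l).

Lemma is_deriveC_eq f t l l' : is_deriveC f t l -> l = l' -> is_deriveC f t l'.
Proof. intros h <-; exact h. Qed.

Lemma is_deriveC_plus f g t l k :
  is_deriveC f t l -> is_deriveC g t k ->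
  is_deriveC (fun s => (f s + g s)%C) t (l + k)%C.
Proof.
  intros [f1 f2] [g1 g2]; split; simpl.
  - exact (is_derive_plus (V := R_NormedModule) _ _ _ _ _ f1 g1).
  - exact (is_derive_plus (V := R_NormedModule) _ _ _ _ _ f2 g2).
Qed.

Lemma is_derive_mult_minus_mult (a b c d : R -> R) t a' b' c' d' :
  is_derive a t a' -> is_derive b t b' -> is_derive c t c' -> is_derive d t d' ->
  is_derive (fun s => a s * b s - c s * d s) t
    (a' * b t + a t * b' - (c' * d t + c t * d')).
Proof.
  intros ha hb hc hd. auto_derive.
  - repeat split; eexists; eassumption.
  - rewrite (is_derive_unique (fun s : R => a s) _ _ ha), (is_derive_unique (fun s : R => b s) _ _ hb),
      (is_derive_unique (fun s : R => c s) _ _ hc), (is_derive_unique (fun s : R => d s) _ _ hd). ring.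
Qed.

Lemma is_derive_mult_plus_mult (a b c d : R -> R) t a' b' c' d' :
  is_derive a t a' -> is_derive b t b' -> is_derive c t c' -> is_derive d t d' ->
  is_derive (fun s => a s * b s + c s * d s) t
    (a' * b t + a t * b' + (c' * d t + c t * d')).
Proof.
  intros ha hb hc hd. auto_derive.
  - repeat split; eexists; eassumption.
  - rewrite (is_derive_unique (fun s : R => a s) _ _ ha), (is_derive_unique (fun s : R => b s) _ _ hb),
      (is_derive_unique (fun s : R => c s) _ _ hc), (is_derive_unique (fun s : R => d s) _ _ hd). ring.
Qed.

Lemma is_deriveC_mult f g t l k :
  is_deriveC f t l -> is_deriveC g t k ->
  is_deriveC (fun s => (f s * g s)%C) t (l * g t + f t * k)%C.
Proof.
  intros [f1 f2] [g1 g2]; split.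
  - replace (Re (l * g t + f t * k)%C) with
      (Re l * Re (g t) + Re (f t) * Re k - (Im l * Im (g t) + Im (f t) * Im k))
      by (unfold Re, Im; simpl; ring).
    exact (is_derive_mult_minus_mult _ _ _ _ _ _ _ _ _ f1 g1 f2 g2).
  - replace (Im (l * g t + f t * k)%C) with
      (Re l * Im (g t) + Re (f t) * Im k + (Im l * Re (g t) + Im (f t) * Re k))
      by (unfold Re, Im; simpl; ring).
    exact (is_derive_mult_plus_mult _ _ _ _ _ _ _ _ _ f1 g2 f2 g1).
Qed.

Lemma is_deriveC_scal (c : C) f t l :
  is_deriveC f t l -> is_deriveC (fun s => (c * f s)%C) t (c * l)%C.
Proof.
  intros h. apply is_deriveC_eq with (0 * f t + c * l)%C; [|ring].
  apply (is_deriveC_mult (fun _ => c)); [|exact h].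
  split; apply @is_derive_const.
Qed.

Lemma is_deriveC_conj f t l :
  is_deriveC f t l -> is_deriveC (fun s => Cconj (f s)) t (Cconj l).
Proof.
  intros [h1 h2]; split; simpl; [exact h1|].
  exact (is_derive_opp (V := R_NormedModule) _ _ _ h2).
Qed.

Lemma is_deriveC_zero_const f :
  (forall s, is_deriveC f s 0) -> forall s t, f s = f t.
Proof.
  intros h s t. apply injective_projections.
  - apply (is_derive_zero_const (fun s => Re (f s))). intros; apply h.
  - apply (is_derive_zero_const (fun s => Im (f s))). intros; apply h.
Qed.

Lemma smooth_is_derive f t : smooth f -> is_derive f t (Derive f t).
Proof. intros h. apply Derive_correct, (h 1%nat t). Qed.

Lemma smoothC_is_deriveC f t : smoothC f -> is_deriveC f t (DC f t).
Proof. intros [h1 h2]; split; simpl; apply smooth_is_derive; assumption. Qed.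

(** * Row vectors and frames *)

Definition rdot (r v : C3) : C := (x1 r * x1 v + x2 r * x2 v + x3 r * x3 v)%C.

Lemma det3_rdot (r1 r2 r3 v1 v2 v3 : C3) :
  det3 (rdot r1 v1, rdot r1 v2, rdot r1 v3)
       (rdot r2 v1, rdot r2 v2, rdot r2 v3)
       (rdot r3 v1, rdot r3 v2, rdot r3 v3)
  = (det3 r1 r2 r3 * det3 v1 v2 v3)%C.
Proof. unfold det3, rdot, x1, x2, x3; simpl; ring. Qed.

Lemma C_mult_eq0_r (d z : C) : d <> 0%C -> (d * z)%C = 0%C -> z = 0%C.
Proof.
  intros hd h.
  replace z with (/ d * (d * z))%C by (field; exact hd).
  rewrite h; ring.
Qed.

Lemma rdot_inj (r1 r2 r3 v w : C3) : det3 r1 r2 r3 <> 0%C ->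
  rdot r1 v = rdot r1 w -> rdot r2 v = rdot r2 w -> rdot r3 v = rdot r3 w ->
  v = w.
Proof.
  intros hd h1 h2 h3.
  assert (key : forall a b : C, (det3 r1 r2 r3 * (a - b))%C = 0%C -> a = b).
  { intros a b h. apply C_mult_eq0_r in h; [|exact hd].
    replace a with ((a - b) + b)%C by ring. rewrite h; ring. }
  destruct v as [[v1 v2] v3], w as [[w1 w2] w3].
  unfold rdot, x1, x2, x3 in h1, h2, h3; simpl in h1, h2, h3.
  assert (k1 : forall a b : C, a = b -> (a - b)%C = 0%C) by (intros a b ->; ring).
  apply k1 in h1; apply k1 in h2; apply k1 in h3.
  destruct r1 as [[a1 a2] a3], r2 as [[b1 b2] b3], r3 as [[d1 d2] d3].
  unfold det3, x1, x2, x3 in *; simpl in *.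
  f_equal; [f_equal|]; apply key.
  (* Cramer's rule: the coefficients are the cofactors of one column of the matrix of rows. *)
  - transitivity ((b2 * d3 - b3 * d2) * (a1 * v1 + a2 * v2 + a3 * v3 - (a1 * w1 + a2 * w2 + a3 * w3))
      - (a2 * d3 - a3 * d2) * (b1 * v1 + b2 * v2 + b3 * v3 - (b1 * w1 + b2 * w2 + b3 * w3))
      + (a2 * b3 - a3 * b2) * (d1 * v1 + d2 * v2 + d3 * v3 - (d1 * w1 + d2 * w2 + d3 * w3)))%C;
      [ring|rewrite h1, h2, h3; ring].
  - transitivity (- (b1 * d3 - b3 * d1) * (a1 * v1 + a2 * v2 + a3 * v3 - (a1 * w1 + a2 * w2 + a3 * w3))
      + (a1 * d3 - a3 * d1) * (b1 * v1 + b2 * v2 + b3 * v3 - (b1 * w1 + b2 * w2 + b3 * w3))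
      - (a1 * b3 - a3 * b1) * (d1 * v1 + d2 * v2 + d3 * v3 - (d1 * w1 + d2 * w2 + d3 * w3)))%C;
      [ring|rewrite h1, h2, h3; ring].
  - transitivity ((b1 * d2 - b2 * d1) * (a1 * v1 + a2 * v2 + a3 * v3 - (a1 * w1 + a2 * w2 + a3 * w3))
      - (a1 * d2 - a2 * d1) * (b1 * v1 + b2 * v2 + b3 * v3 - (b1 * w1 + b2 * w2 + b3 * w3))
      + (a1 * b2 - a2 * b1) * (d1 * v1 + d2 * v2 + d3 * v3 - (d1 * w1 + d2 * w2 + d3 * w3)))%C;
      [ring|rewrite h1, h2, h3; ring].
Qed.

Lemma mulmv_ctrans A w :
  mulmv (ctrans A) w = (dot (col1 A) w, dot (col2 A) w, dot (col3 A) w).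
Proof.
  unfold mulmv, ctrans, add3, scal3, dot, col1, col2, col3, x1, x2, x3.
  cbn [fst snd]. f_equal; [f_equal|]; ring.
Qed.

Lemma inG_gram A : inG A ->
  (herm (col1 A) (col1 A) = 0 /\ herm (col2 A) (col1 A) = 0 /\ herm (col3 A) (col1 A) = - Ci
  /\ herm (col1 A) (col2 A) = 0 /\ herm (col2 A) (col2 A) = 1 /\ herm (col3 A) (col2 A) = 0
  /\ herm (col1 A) (col3 A) = Ci /\ herm (col2 A) (col3 A) = 0 /\ herm (col3 A) (col3 A) = 0)%C.
Proof.
  intros [_ h]. unfold mulm in h. rewrite !mulmv_ctrans in h.
  repeat split.
  - exact (f_equal (fun M => x1 (col1 M)) h).
  - exact (f_equal (fun M => x2 (col1 M)) h).
  - exact (f_equal (fun M => x3 (col1 M)) h).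
  - exact (f_equal (fun M => x1 (col2 M)) h).
  - exact (f_equal (fun M => x2 (col2 M)) h).
  - exact (f_equal (fun M => x3 (col2 M)) h).
  - exact (f_equal (fun M => x1 (col3 M)) h).
  - exact (f_equal (fun M => x2 (col3 M)) h).
  - exact (f_equal (fun M => x3 (col3 M)) h).
Qed.

(* The system [f' = f K] satisfied by each row of a Wilczynski frame. *)
Definition row_solution (k t : R -> R) (f1 f2 f3 : R -> C) : Prop :=
  forall s,
    is_deriveC f1 s (Ci * RtoC (k s) * f1 s + f3 s)%C /\
    is_deriveC f2 s (- Ci * f1 s - RtoC 2 * Ci * RtoC (k s) * f2 s)%C /\
    is_deriveC f3 s (RtoC (t s) * f1 s + f2 s + Ci * RtoC (k s) * f3 s)%C.

(** This is [y h] times the conjugate transpose of [f]. As [h] is its own inverse, it is the form on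
    rows dual to [herm]. *)
Definition row_pairing (y1 y2 y3 f1 f2 f3 : R -> C) (s : R) : C :=
  (Ci * (y1 s * Cconj (f3 s))
   + (y2 s * Cconj (f2 s) + (- Ci) * (y3 s * Cconj (f1 s))))%C.

(* [K] is skew for the Hermitian form, so it preserves the dual form on rows. *)
Lemma row_solution_pairing_const k t f1 f2 f3 y1 y2 y3 :
  row_solution k t f1 f2 f3 -> row_solution k t y1 y2 y3 ->
  forall s s', row_pairing y1 y2 y3 f1 f2 f3 s = row_pairing y1 y2 y3 f1 f2 f3 s'.
Proof.
  intros hf hy. apply is_deriveC_zero_const. unfold row_pairing.
  intros s. destruct (hf s) as [d1 [d2 d3]], (hy s) as [e1 [e2 e3]].
  eapply is_deriveC_eq.
  - apply is_deriveC_plus; [|apply is_deriveC_plus].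
    + apply is_deriveC_scal, is_deriveC_mult; [exact e1|apply is_deriveC_conj, d3].
    + apply is_deriveC_mult; [exact e2|apply is_deriveC_conj, d2].
    + apply is_deriveC_scal, is_deriveC_mult; [exact e3|apply is_deriveC_conj, d1].
  - cbv beta. destruct (f1 s) as [a1 b1], (f2 s) as [a2 b2], (f3 s) as [a3 b3],
      (y1 s) as [u1 v1], (y2 s) as [u2 v2], (y3 s) as [u3 v3].
    unfold Cconj, Cmult, Cplus, Copp, Cminus, Ci, RtoC; simpl.
    apply injective_projections; simpl; ring.
Qed.

(** The row sought is [y F^-1]. Membership in [G] gives [F^-1 = h F^* h], so [y F^-1] is the triple
    of pairings of [y] with the rows of [F], multiplied by [h]. These pairings are constant, which
    explains the witness; the Gram relations of the columns then verify it. *)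
Lemma frame_row_exists (F : R -> M3) (k t : R -> R) (y1 y2 y3 : R -> C) :
  smoothM F ->
  (forall s, inG (F s) /\ DM F s = mulm (F s) (scalm (RtoC 1) (Kmat (k s) (t s)))) ->
  row_solution k t y1 y2 y3 ->
  exists r, forall s, rdot r (col1 (F s)) = y1 s /\ rdot r (col2 (F s)) = y2 s
    /\ rdot r (col3 (F s)) = y3 s.
Proof.
  intros [[S11 [S12 S13]] [[S21 [S22 S23]] [S31 [S32 S33]]]] HF hy.
  set (entry := fun (xi : C3 -> C) (ci : M3 -> C3) s => xi (ci (F s))).
  assert (rows :
    row_solution k t (entry x1 col1) (entry x1 col2) (entry x1 col3) /\
    row_solution k t (entry x2 col1) (entry x2 col2) (entry x2 col3) /\
    row_solution k t (entry x3 col1) (entry x3 col2) (entry x3 col3)).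
  { refine (conj _ (conj _ _)); intros s; destruct (HF s) as [_ E];
      refine (conj _ (conj _ _));
      (eapply is_deriveC_eq; [apply smoothC_is_deriveC; assumption|]).
    all: unfold entry; match goal with |- DC (fun s => ?xi (?ci (?G s))) ?u = _ =>
           transitivity (xi (ci (DM G u))); [reflexivity|rewrite E] end.
    all: unfold mulm, mulmv, scalm, Kmat, scal3, add3, col1, col2, col3, x1, x2, x3; simpl; ring. }
  destruct rows as [r1 [r2 r3]].
  set (rho := fun xi =>
    row_pairing y1 y2 y3 (entry xi col1) (entry xi col2) (entry xi col3)).
  set (rho1 := rho x1). set (rho2 := rho x2). set (rho3 := rho x3).
  exists ((- Ci * rho3 0)%C, rho2 0, (Ci * rho1 0)%C).
  intros s.
  assert (E1 : rho1 0 = rho1 s) by exact (row_solution_pairing_const _ _ _ _ _ _ _ _ r1 hy 0 s).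
  assert (E2 : rho2 0 = rho2 s) by exact (row_solution_pairing_const _ _ _ _ _ _ _ _ r2 hy 0 s).
  assert (E3 : rho3 0 = rho3 s) by exact (row_solution_pairing_const _ _ _ _ _ _ _ _ r3 hy 0 s).
  rewrite E1, E2, E3.
  destruct (HF s) as [HG _].
  destruct (inG_gram _ HG) as [g11 [g21 [g31 [g12 [g22 [g32 [g13 [g23 g33]]]]]]]].
  assert (expand : forall v, rdot ((- Ci * rho3 s)%C, rho2 s, (Ci * rho1 s)%C) v
    = (Ci * y1 s * herm (col3 (F s)) v + y2 s * herm (col2 (F s)) v
       - Ci * y3 s * herm (col1 (F s)) v)%C).
  { intros v. unfold rho1, rho2, rho3, rho, row_pairing, entry, rdot, herm, dot, mulmv, hmat, scal3, add3,
      col1, col2, col3, x1, x2, x3; simpl; ring. }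
  assert (CC : (Ci * Ci)%C = (- (1))%C)
    by (unfold Ci; apply injective_projections; simpl; ring).
  repeat split; rewrite expand.
  - rewrite g31, g21, g11. transitivity (- (Ci * Ci) * y1 s)%C; [ring|rewrite CC; ring].
  - rewrite g32, g22, g12. ring.
  - rewrite g33, g23, g13. transitivity (- (Ci * Ci) * y3 s)%C; [ring|rewrite CC; ring].
Qed.

(** * Eigenrows *)

(* Left eigenvector, for the eigenvalue [- i l / 3], of the matrix
   [L = [[0, p, 2 t / 3], [- i t / 3, 0, - i p^*], [1, - t / 3, 0]]] with
   [p = t' / 3 + i (k t - 1)].  Along a critical curve [L' = L K - K L], so that
   [F L F^-1] is constant; here [t1] stands for [t']. *)
Definition eigenrow (l k t t1 : R) : C3 :=
  ((0, t ^ 2 - 3 * l), (3 * t1, 9 * (k * t - 1) + t * l),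
   (- 3 * t * (k * t - 1) - l ^ 2, t * t1)).

(** The hypothesis [E] is [Qc c1 c2 l = 0] with the modulus written through [k], [t], [t1], and
    [(e, g)] is the logarithmic derivative of the scalar factor. The pairs added on the left are the
    derivatives of the entries of the eigenrow, with [t k' = - 2 k t'] substituted. Stating [e] and
    [g] through their products with [D] turns each claim, once multiplied by [D], into a polynomial
    consequence of the hypotheses. *)
Lemma eigenrow_derivative (l k t t1 D e g : R) :
  D = t ^ 2 - 3 * l -> D <> 0 ->
  l ^ 3 + 6 * (k * t ^ 2) * l
    + (27 - 54 * k * t + 27 * k ^ 2 * t ^ 2 - 2 * t ^ 3 + 3 * t1 ^ 2) = 0 ->
  e * D = - (t * t1) ->
  g * D = k * D + l ^ 2 + 3 * (k * t ^ 2) - 3 * t ->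
  let t2 := t ^ 2 - 9 * k * (1 - k * t) in
  let q := k * t - 1 in
  let u := eigenrow l k t t1 in
  (((e, g) * x1 u + (0, 2 * t * t1)%R) = Ci * RtoC k * x1 u + x3 u /\
   ((e, g) * x2 u + (3 * t2, l * t1 - 9 * k * t1)%R)
     = - Ci * x1 u - RtoC 2 * Ci * RtoC k * x2 u /\
   ((e, g) * x3 u + (- 3 * t1 * q + 3 * t * (k * t1), t1 ^ 2 + t * t2)%R)
     = RtoC t * x1 u + x2 u + Ci * RtoC k * x3 u)%C.
Proof.
  intros hD hD0 E hA hB t2 q u.
  assert (key : forall a b, D * a = D * b -> a = b)
    by (intros a b h; exact (Rmult_eq_reg_l D a b h hD0)).
  unfold u, eigenrow, t2, q; clear u t2 q.
  refine (conj _ (conj _ _)); apply injective_projections; cbn -[pow];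
    apply key; clear key; subst D; simpl in *; nsatz.
Qed.

Definition cis (a : R) : C := (cos a, sin a).

Lemma cis_plus a b : cis (a + b) = (cis a * cis b)%C.
Proof.
  unfold cis. apply injective_projections; simpl;
    [rewrite cos_plus | rewrite sin_plus]; ring.
Qed.

Lemma is_deriveC_pair (a b : R -> R) t a' b' :
  is_derive a t a' -> is_derive b t b' ->
  is_deriveC (fun s => (a s, b s)) t (a', b').
Proof. intros ha hb; split; assumption. Qed.

Lemma is_deriveC_cis (th : R -> R) t g :
  is_derive th t g -> is_deriveC (fun s => cis (th s)) t ((0, g) * cis (th t))%C.
Proof.
  intros h. apply is_deriveC_eq with (- (g * sin (th t)), g * cos (th t)).
  - apply is_deriveC_pair; (auto_derive; [exists g; exact h|]);
      rewrite (is_derive_unique (fun x : R => th x) _ _ h); ring.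
  - unfold cis; apply injective_projections; simpl; ring.
Qed.

Lemma is_derive_inv_sqrt (h : R -> R) t h' :
  0 < h t -> is_derive h t h' ->
  is_derive (fun s => / sqrt (h s)) t (/ sqrt (h t) * (- h' / (2 * h t))).
Proof.
  intros hp hd.
  assert (hsq : 0 < sqrt (h t)) by (apply sqrt_lt_R0, hp).
  auto_derive.
  - repeat split; [exists h'; exact hd|exact hp|lra].
  - rewrite (is_derive_unique (fun x : R => h x) _ _ hd).
    replace (- h' / (2 * h t)) with (- h' / (2 * (sqrt (h t) * sqrt (h t))))
      by (rewrite sqrt_sqrt by lra; reflexivity).
    field. lra.
Qed.

(** [sg] carries the sign of [t^2 - 3 l], so that one formula serves eigenvalues of either kind. The
    inverse square root integrates [e = - D' / (2 D)] and [th] integrates [g]. *)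
Lemma eigenrow_solution (l c1 c2 sg : R) (k t t1 k1 th : R -> R) :
  Qc c1 c2 l = 0 ->
  (forall s, is_derive t s (t1 s)) ->
  (forall s, is_derive t1 s (t s ^ 2 - 9 * k s * (1 - k s * t s))) ->
  (forall s, is_derive k s (k1 s)) ->
  (forall s, t s * k1 s = - 2 * k s * t1 s) ->
  (forall s, k s * t s ^ 2 = c1) ->
  (forall s, - 18 * k s * t s + 9 * k s ^ 2 * t s ^ 2 - 2 / 3 * t s ^ 3
      + t1 s ^ 2 = c2) ->
  (forall s, 0 < sg * (t s ^ 2 - 3 * l)) ->
  (forall s, is_derive th s
     (k s + (l ^ 2 + 3 * c1 - 3 * t s) / (t s ^ 2 - 3 * l))) ->
  let f := fun s => (RtoC (/ sqrt (sg * (t s ^ 2 - 3 * l)))%R * cis (th s))%C in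
  row_solution k t
    (fun s => f s * x1 (eigenrow l (k s) (t s) (t1 s)))%C
    (fun s => f s * x2 (eigenrow l (k s) (t s) (t1 s)))%C
    (fun s => f s * x3 (eigenrow l (k s) (t s) (t1 s)))%C.
Proof.
  intros hq dt dt1 dk hk1 hc1 hc2 hs dth f s.
  set (D := t s ^ 2 - 3 * l).
  assert (hD : D <> 0) by (intros h; specialize (hs s); fold D in hs; rewrite h in hs; lra).
  set (e := - (t s * t1 s) / D).
  set (g := k s + (l ^ 2 + 3 * c1 - 3 * t s) / D).
  assert (df : is_deriveC f s (f s * (e, g))%C).
  { unfold f. apply is_deriveC_eq with
      (RtoC (/ sqrt (sg * D) * e)%R * cis (th s)
       + RtoC (/ sqrt (sg * D))%R * ((0, g) * cis (th s)))%C.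
    - apply (is_deriveC_mult (fun s => RtoC (/ sqrt (sg * (t s ^ 2 - 3 * l))))
        (fun s => cis (th s)) s (RtoC (/ sqrt (sg * D) * e)) ((0, g) * cis (th s))%C).
      + apply is_deriveC_pair; [|apply @is_derive_const].
        assert (hs' := hs s). fold D in hs'.
        assert (hsg : sg <> 0) by (intros h; rewrite h in hs'; lra).
        replace e with (- (sg * (2 * t s * t1 s)) / (2 * (sg * D)))
          by (unfold e; field; split; assumption).
        apply (is_derive_inv_sqrt (fun s => sg * (t s ^ 2 - 3 * l))); [exact hs'|].
        auto_derive; [ex_derive_hyp|].
        rewrite !(is_derive_unique _ _ _ (dt _)); ring.
      + apply is_deriveC_cis, dth.
    - unfold f. fold D. apply injective_projections; simpl; fold D; ring. }
  destruct (eigenrow_derivative l (k s) (t s) (t1 s) D e g) as [E1 [E2 E3]].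
  { reflexivity. } { exact hD. }
  { rewrite <- hq. unfold Qc. rewrite hc1, <- (hc2 s). field. }
  { unfold e; field; exact hD. }
  { unfold g. rewrite hc1. field; exact hD. }
  assert (step : forall (u : R -> C) (u' v : C), is_deriveC u s u' ->
     ((e, g) * u s + u')%C = v -> is_deriveC (fun s => f s * u s)%C s (f s * v)%C).
  { intros u u' v du hv. eapply is_deriveC_eq; [apply is_deriveC_mult; eassumption|].
    rewrite <- hv. ring. }
  refine (conj _ (conj _ _)); (eapply is_deriveC_eq; [eapply step|]).
  - apply is_deriveC_pair; [apply @is_derive_const|].
    instantiate (1 := 2 * t s * t1 s).
    auto_derive; [ex_derive_hyp|].
    rewrite !(is_derive_unique _ _ _ (dt _)); ring.
  - exact E1.
  - ring.
  - apply is_deriveC_pair.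
    + instantiate (1 := 3 * (t s ^ 2 - 9 * k s * (1 - k s * t s))).
      apply (is_derive_scal t1), dt1.
    + instantiate (1 := l * t1 s - 9 * k s * t1 s).
      auto_derive; [ex_derive_hyp|].
      rewrite !(is_derive_unique _ _ _ (dt _)), !(is_derive_unique _ _ _ (dk _)).
      specialize (hk1 s). lra.
  - exact E2.
  - ring.
  - apply is_deriveC_pair.
    + instantiate (1 := - 3 * t1 s * (k s * t s - 1) + 3 * t s * (k s * t1 s)).
      auto_derive; [ex_derive_hyp|].
      rewrite !(is_derive_unique _ _ _ (dt _)), !(is_derive_unique _ _ _ (dk _)).
      specialize (hk1 s).
      transitivity (-3 * t1 s * (k s * t s - 1) + -3 * t s * (t s * k1 s + k s * t1 s));
        [ring|rewrite hk1; ring].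
    + instantiate (1 := t1 s ^ 2 + t s * (t s ^ 2 - 9 * k s * (1 - k s * t s))).
      auto_derive; [ex_derive_hyp|].
      rewrite !(is_derive_unique _ _ _ (dt _)), !(is_derive_unique _ _ _ (dt1 _)).
      ring.
  - exact E3.
  - ring.
Qed.

(** A Vandermonde factor, nonzero for distinct eigenvalues, times a number with imaginary part
    [- 9 t1]. Independence is therefore visible at any time where the twist is moving. *)
Lemma det3_eigenrow (l1 l2 l3 k t t1 : R) :
  det3 (eigenrow l1 k t t1) (eigenrow l2 k t t1) (eigenrow l3 k t t1)
  = (RtoC ((l2 - l1) * (l3 - l1) * (l3 - l2))
     * (t ^ 3 + 27 * (k * t - 1), - 9 * t1)%R)%C.
Proof.
  unfold det3, eigenrow, x1, x2, x3. apply injective_projections; simpl; ring.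
Qed.

Lemma det3_scal (a b c : C) (u v w : C3) :
  det3 (scal3 a u) (scal3 b v) (scal3 c w) = (a * b * c * det3 u v w)%C.
Proof. unfold det3, scal3, x1, x2, x3; simpl; ring. Qed.

(** * Moduli, phases and rational multiples of a full turn *)

Definition normsq (z : C) : R := Re z ^ 2 + Im z ^ 2.

Lemma normsq_mult z w : normsq (z * w)%C = normsq z * normsq w.
Proof. unfold normsq, Re, Im; simpl; ring. Qed.

Lemma cos_eq_1 x : cos x = 1 -> exists m : Z, x = 2 * PI * IZR m.
Proof.
  intros h. replace x with (2 * (x / 2)) in h by field.
  rewrite cos_2a_sin in h.
  assert (h' : sin (x / 2) = 0) by nra.
  destruct (sin_eq_0_0 _ h') as [m hm]. exists m. lra.
Qed.

Lemma cis_2PI (m : Z) a : a = 2 * PI * IZR m -> cis a = 1%C.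
Proof.
  intros ->.
  unfold cis. rewrite Rmult_comm, <- (Rplus_0_l (IZR m * (2 * PI))).
  rewrite (quasi_periodic_IZR cos (2 * PI) 0), (quasi_periodic_IZR sin (2 * PI) 0);
    [rewrite cos_0, sin_0; apply injective_projections; simpl; ring| |];
    intros s; rewrite ?cos_plus, ?sin_plus, cos_2PI, sin_2PI; ring.
Qed.

Lemma cis_cube_eq_1 a : (cis a * cis a * cis a)%C = 1%C -> exists m : Z, 3 * a = 2 * PI * IZR m.
Proof.
  intros h. rewrite <- !cis_plus in h.
  apply cos_eq_1. replace (3 * a) with (a + a + a) by ring.
  exact (f_equal fst h).
Qed.

Lemma is_rational_IZR_div (m n : Z) : (0 < n)%Z -> is_rational (IZR m / IZR n).
Proof.
  intros hn. destruct n as [|n|n]; try lia.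
  exists (QArith_base.Qmake m n). reflexivity.
Qed.

Lemma is_rational_multiple x : is_rational x ->
  exists n : Z, (0 < n)%Z /\ exists m : Z, IZR n * x = IZR m.
Proof.
  intros [[m n] ->]. exists (Zpos n); split; [lia|].
  exists m. unfold Q2R; simpl. field. apply not_0_IZR; lia.
Qed.

Lemma line_ext p q : (forall w, line p w <-> line q w) -> p = q.
Proof.
  destruct p as [lp hp], q as [lq hq]; simpl; intros h.
  assert (E : lp = lq).
  { apply functional_extensionality; intros w.
    apply propositional_extensionality, h. }
  subst lq. f_equal. apply proof_irrelevance.
Qed.

(** * The twist of a curve of type [B1'] *)

Lemma is_derive_phi c1 x : x <> 0 ->
  is_derive (phi c1) x (2 * x + 18 * c1 / x ^ 3 - 27 * c1 ^ 2 / x ^ 4).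
Proof.
  intros hx. unfold phi. auto_derive.
  - repeat split; simpl; repeat apply Rmult_integral_contrapositive_currified;
      try assumption; lra.
  - simpl; field; assumption.
Qed.

Lemma is_derive_speed2 c1 c2 x : x <> 0 ->
  is_derive (speed2 c1 c2) x (2 * phi c1 x).
Proof.
  intros hx. unfold speed2, phi. auto_derive.
  - repeat split; simpl; repeat apply Rmult_integral_contrapositive_currified;
      try assumption; lra.
  - simpl; field; assumption.
Qed.

(** A finite subcover by half planes gives the bound. It is the upper bound on the twist that
    excludes the unbounded component over [x >= e3]. *)
Lemma compact_fst_bounded (A : R * R -> Prop) : compact_set A ->
  exists M, forall m, A m -> fst m <= M.
Proof.
  intros hA.
  destruct (hA (fun U => exists M, forall m, U m <-> fst m < M)) as [l [hl cov]].
  - intros U [M hU] m hm.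
    assert (hm' := proj1 (hU m) hm).
    assert (hd : 0 < M - fst m) by lra.
    exists (mkposreal _ hd). intros [a b] [h1 _]. apply hU.
    unfold ball in h1; simpl in h1; unfold AbsRing_ball, abs, minus, plus, opp in h1.
    simpl in h1. apply Rabs_def2 in h1; simpl; lra.
  - intros m _. exists (fun p => fst p < fst m + 1); split; [|simpl; lra].
    exists (fst m + 1); intros; reflexivity.
  - assert (hM : exists M, forall U, In U l -> forall m, U m -> fst m <= M).
    { clear cov. induction l as [|U l IH].
      - exists 0; intros U [].
      - destruct IH as [M hM]; [intros V hV; apply hl; right; exact hV|].
        destruct (hl U (or_introl eq_refl)) as [M' hM'].
        exists (Rmax M M'). intros V [<-|hV] m hm.
        + assert (k := proj1 (hM' m) hm). pose proof (Rmax_r M M'). apply Rlt_le, Rlt_le_trans with M'; assumption.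
        + specialize (hM V hV m hm). pose proof (Rmax_l M M'); lra. }
    destruct hM as [M hM]. exists M. intros m hm.
    destruct (cov m hm) as [U [hU hUm]]. exact (hM U hU m hUm).
Qed.

Lemma exists_primitive (h : R -> R) : (forall s, continuity_pt h s) ->
  exists th, forall s, is_derive th s (h s).
Proof.
  intros hc.
  assert (hc' : forall s, continuous h s)
    by (intros s; apply continuity_pt_filterlim, hc).
  exists (fun s => RInt h 0 s). intros s.
  apply (is_derive_RInt (V := R_NormedModule) h _ 0); [|apply hc'].
  apply filter_forall. intros y.
  apply (RInt_correct (V := R_CompleteNormedModule) h).
  apply (ex_RInt_continuous (V := R_CompleteNormedModule)). intros; apply hc'.
Qed.

Lemma nonconstant_derive_neq0 (f f' : R -> R) s t :
  (forall s, is_derive f s (f' s)) -> f s <> f t -> exists u, f' u <> 0.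
Proof.
  intros df h. apply NNPP; intros hn. apply h.
  apply is_derive_zero_const. intros u.
  replace 0 with (f' u); [apply df|].
  apply NNPP; intros k; apply hn; exists u; exact k.
Qed.

(* With [D = t'' - phi t], conservation of the energy gives [t' D = 0]; two
   differentiations, multiplied by [D], give [t'' D = t''' D = 0], hence
   [D D' = 0] and [D^2] is constant.  This rules out curves that rest at a
   turning value. *)
Lemma energy_euler_lagrange (t : R -> R) c1 c2 s s' :
  smooth t -> (forall s, t s <> 0) ->
  (forall s, Derive t s ^ 2 = speed2 c1 c2 (t s)) ->
  t s <> t s' ->
  forall r, is_derive (Derive t) r (phi c1 (t r)).
Proof.
  intros ht t0 en hne.
  set (t1 := Derive t). set (t2 := Derive t1). set (t3 := Derive t2).
  assert (d1 : forall r, is_derive t r (t1 r))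
    by (intros r; apply Derive_correct, (ht 1%nat r)).
  assert (d2 : forall r, is_derive t1 r (t2 r))
    by (intros r; apply Derive_correct, (ht 2%nat r)).
  assert (d3 : forall r, is_derive t2 r (t3 r))
    by (intros r; apply Derive_correct, (ht 3%nat r)).
  set (D := fun r => t2 r - phi c1 (t r)).
  set (D' := fun r => t3 r - t1 r * (2 * t r + 18 * c1 / t r ^ 3 - 27 * c1 ^ 2 / t r ^ 4)).
  assert (dD : forall r, is_derive D r (D' r)).
  { intros r. apply (is_derive_minus (V := R_NormedModule)); [apply d3|].
    apply (is_derive_comp (V := R_NormedModule) (phi c1) t);
      [apply is_derive_phi, t0|apply d1]. }
  assert (prod : forall (a b a' b' : R -> R),
     (forall r, is_derive a r (a' r)) -> (forall r, is_derive b r (b' r)) ->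
     (forall r, a r * b r = 0) -> forall r, a' r * b r + a r * b' r = 0).
  { intros a b a' b' ha hb hz r.
    assert (h : is_derive (fun r => a r * b r) r (a' r * b r + a r * b' r))
      by (apply (is_derive_mult a b); [apply ha|apply hb|exact Rmult_comm]).
    rewrite <- (is_derive_unique _ _ _ h), (Derive_ext _ (fun _ => 0)) by exact hz.
    apply Derive_const. }
  assert (z1 : forall r, t1 r * D r = 0).
  { intros r.
    assert (h1 : is_derive (fun r => t1 r ^ 2) r (t1 r * (2 * phi c1 (t r)))).
    { apply (is_derive_ext (fun r => speed2 c1 c2 (t r))).
      - intros; symmetry; apply en.
      - apply (is_derive_comp (V := R_NormedModule) (speed2 c1 c2) t);
          [apply is_derive_speed2, t0|apply d1]. }
    assert (h2 : is_derive (fun r => t1 r ^ 2) r (INR 2 * t2 r * t1 r ^ 1))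
      by apply (is_derive_pow t1 2 r _ (d2 r)).
    apply is_derive_unique in h1; apply is_derive_unique in h2.
    rewrite h1 in h2. unfold D. simpl in h2. lra. }
  assert (z2 : forall r, t2 r * D r = 0).
  { intros r. assert (h := prod _ _ _ _ d2 dD z1 r).
    assert (h' : (t2 r * D r) * D r = 0)
      by (transitivity (D r * (t2 r * D r + t1 r * D' r) - t1 r * D r * D' r);
          [ring|rewrite h, z1; ring]).
    destruct (Rmult_integral _ _ h') as [|k]; [assumption|rewrite k; ring]. }
  assert (z3 : forall r, t3 r * D r = 0).
  { intros r. assert (h := prod _ _ _ _ d3 dD z2 r).
    assert (h' : (t3 r * D r) * D r = 0)
      by (transitivity (D r * (t3 r * D r + t2 r * D' r) - t2 r * D r * D' r);
          [ring|rewrite h, z2; ring]).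
    destruct (Rmult_integral _ _ h') as [|k]; [assumption|rewrite k; ring]. }
  assert (zD : forall r, D r * D' r = 0).
  { intros r. unfold D' at 1.
    transitivity (t3 r * D r - t1 r * D r *
      (2 * t r + 18 * c1 / t r ^ 3 - 27 * c1 ^ 2 / t r ^ 4));
      [ring|rewrite z1, z3; ring]. }
  assert (cD : forall r r', D r * D r = D r' * D r').
  { apply is_derive_zero_const. intros r.
    replace 0 with (D' r * D r + D r * D' r) by (pose proof (zD r); lra).
    apply (is_derive_mult D D); [apply dD|apply dD|exact Rmult_comm]. }
  intros r. replace (phi c1 (t r)) with (t2 r); [apply d2|].
  enough (D r = 0) by (unfold D in H; lra).
  (* If [D r <> 0], constancy of [D^2] makes [D] nonzero everywhere. Then [t1 D = 0] gives [t1 = 0]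
     throughout, and [t] would be constant. *)
  apply NNPP; intros hr. apply hne.
  apply is_derive_zero_const. intros u.
  replace 0 with (t1 u); [apply d1|].
  destruct (Rmult_integral _ _ (z1 u)) as [|hu]; [assumption|exfalso].
  specialize (cD r u). rewrite hu in cD.
  destruct (Rmult_integral (D r) (D r)); lra.
Qed.

Lemma is_derive_reverse (f f' : R -> R) :
  (forall s, is_derive f s (f' s)) ->
  forall s, is_derive (fun s => f (- s)) s (- f' (- s)).
Proof.
  intros h s. auto_derive.
  - exists (f' (- s)). apply h.
  - rewrite (is_derive_unique (fun x : R => f x) (- s) _ (h _)). ring.
Qed.

Lemma is_derive_opp_fun (f f' : R -> R) :
  (forall s, is_derive f s (f' s)) ->
  forall s, is_derive (fun s => - f s) s (- f' s).
Proof. intros h s. exact (is_derive_opp (V := R_NormedModule) f s _ (h s)). Qed.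

Lemma is_derive_reverse_neg (f g : R -> R) :
  (forall s, is_derive f s (g s)) ->
  forall s, is_derive (fun s => - f (- s)) s (g (- s)).
Proof.
  intros h s. rewrite <- (Ropp_involutive (g (- s))).
  apply (is_derive_opp_fun (fun s => f (- s)) (fun s => - g (- s))).
  apply is_derive_reverse, h.
Qed.

Section Twist.
Variables (t t1 : R -> R) (c1 c2 e1 e2 e3 a b : R).
Hypotheses (he1 : e1 < e2) (he2 : e2 < 0) (he3 : 0 < e3) (hb : b <> 0).
Hypothesis hP : forall x, Pc c1 c2 x
      = (x - e1) * (x - e2) * (x - e3) * ((x - a) ^ 2 + b ^ 2).
Hypothesis dt : forall s, is_derive t s (t1 s).
Hypothesis dt1 : forall s, is_derive t1 s (phi c1 (t s)).
Hypothesis en : forall s, t1 s ^ 2 = speed2 c1 c2 (t s).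
Hypothesis t0 : forall s, t s <> 0.
Hypothesis nc : exists s s', t s <> t s'.

Lemma twist_Pc s : Pc c1 c2 (t s) = 3 / 2 * (t s * t1 s) ^ 2.
Proof. rewrite Pc_speed2 by apply t0. rewrite <- en. ring. Qed.

Lemma twist_cases s : e1 <= t s <= e2 \/ e3 <= t s.
Proof.
  apply (Pc_nonneg_range c1 c2 e1 e2 e3 a b); try assumption; try lra.
  rewrite twist_Pc. pose proof (pow2_ge_0 (t s * t1 s)). lra.
Qed.

Lemma speed2_phi_regular x : x <> 0 ->
  continuity_pt (speed2 c1 c2) x /\ continuity_pt (phi c1) x /\
  (speed2 c1 c2 x = 0 -> phi c1 x <> 0).
Proof.
  intros hx. split; [|split].
  - eapply is_derive_continuity_pt, is_derive_speed2, hx.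
  - eapply is_derive_continuity_pt, is_derive_phi, hx.
  - intros h. apply (phi_root_neq0 c1 c2 e1 e2 e3 a b); try assumption; try lra.
    rewrite Pc_speed2, h by exact hx; ring.
Qed.

Lemma twist_turning_forward s M : 0 < t1 s -> (forall r, t r <= M) ->
  (forall x, t s <= x <= M -> x <> 0) ->
  exists s', s < s' /\ t1 s' = 0 /\ (forall r, s <= r < s' -> 0 < t1 r) /\ t s < t s'.
Proof.
  intros hs hM h0.
  destruct (first_turning_point t t1 (speed2 c1 c2) (phi c1) s M dt dt1 en hM)
    as [s' [h1 [h2 h3]]]; [|exact hs|].
  - intros y hy. apply speed2_phi_regular, h0, hy.
  - exists s'; repeat split; try assumption.
    apply derive_pos_increasing with t1; [assumption|exact dt|].
    intros; apply h3; lra.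
Qed.

Lemma twist_turning_backward s M : t1 s < 0 -> (forall r, t r <= M) ->
  (forall x, t s <= x <= M -> x <> 0) ->
  exists s', s' < s /\ t1 s' = 0 /\ t s < t s'.
Proof.
  intros hs hM h0.
  destruct (first_turning_point (fun r => t (- r)) (fun r => - t1 (- r))
      (speed2 c1 c2) (phi c1) (- s) M) as [s' [h1 [h2 h3]]].
  - apply is_derive_reverse, dt.
  - apply (is_derive_reverse_neg t1 (fun s => phi c1 (t s))), dt1.
  - intros r. rewrite <- en. ring.
  - intros; apply hM.
  - intros y. rewrite Ropp_involutive. intros hy. apply speed2_phi_regular, h0, hy.
  - rewrite Ropp_involutive. lra.
  - exists (- s'). split; [lra|]. split; [lra|].
    replace (t s) with (t (- - s)) by (f_equal; ring).
    apply (derive_pos_increasing (fun r => t (- r)) (fun r => - t1 (- r)));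
      [assumption|apply is_derive_reverse, dt|intros; apply h3; lra].
Qed.

Lemma twist_turning_value s : t1 s = 0 -> t s = e1 \/ t s = e2 \/ t s = e3.
Proof.
  intros h. apply (Pc_root_cases c1 c2 e1 e2 e3 a b); try assumption.
  rewrite twist_Pc, h; ring.
Qed.

(** The twist never vanishes, so by the intermediate value theorem it stays on one side of [0]. On
    the side [>= e3], a nonconstant bounded twist would have a turning value strictly above [e3],
    where [P] has no root. *)
Lemma twist_range M : (forall s, t s <= M) -> forall s, e1 <= t s <= e2.
Proof.
  intros hM s. destruct (twist_cases s) as [|h3]; [assumption|exfalso].
  assert (ct : continuity t)
    by (intros r; exact (is_derive_continuity_pt _ _ _ (dt r))).
  assert (pos : forall r, e3 <= t r).
  { intros r. destruct (twist_cases r) as [hr|]; [exfalso|assumption].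
    destruct (IVT_gen t r s 0 ct) as [u [_ hu]].
    - rewrite Rmin_left, Rmax_right by lra; lra.
    - exact (t0 u hu). }
  destruct nc as [u [u' hu]].
  destruct (nonconstant_derive_neq0 t t1 u u' dt hu) as [r hr].
  assert (h0 : forall x, t r <= x <= M -> x <> 0)
    by (intros x hx; specialize (pos r); lra).
  assert (exists r', t1 r' = 0 /\ t r < t r') as [r' [z1 z2]].
  { destruct (Rtotal_order (t1 r) 0) as [k|[k|k]]; [|contradiction|].
    - destruct (twist_turning_backward r M k hM h0) as [r' [_ [? ?]]].
      exists r'; split; assumption.
    - destruct (twist_turning_forward r M k hM h0) as [r' [_ [? [_ ?]]]].
      exists r'; split; assumption. }
  specialize (pos r).
  destruct (twist_turning_value r' z1) as [k|[k|k]]; lra.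
Qed.

Hypothesis hr : forall s, e1 <= t s <= e2.

Lemma twist_reflection c : t1 c = 0 -> forall r, t (c + r) = t (c - r).
Proof.
  destruct (C1_lipschitz (phi c1)
    (fun x => 2 * x + 18 * c1 / x ^ 3 - 27 * c1 ^ 2 / x ^ 4) e1 e2) as [L [hL lip]].
  - lra.
  - intros x hx; apply is_derive_phi; lra.
  - intros x hx. apply continuity_pt_filterlim.
    apply (ex_derive_continuous
      (fun x => 2 * x + 18 * c1 / x ^ 3 - 27 * c1 ^ 2 / x ^ 4)).
    assert (x <> 0) by lra.
    auto_derive. repeat split; simpl;
      repeat apply Rmult_integral_contrapositive_currified; try assumption; lra.
  - intros hc. exact (turning_point_reflection t t1 (phi c1) e1 e2 L c dt dt1 hr hL lip hc).
Qed.

Lemma twist_increases_somewhere : exists s, 0 < t1 s.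
Proof.
  destruct nc as [u [u' hu]].
  destruct (nonconstant_derive_neq0 t t1 u u' dt hu) as [s hs].
  destruct (Rtotal_order (t1 s) 0) as [k|[k|k]];
    [|contradiction|exists s; exact k].
  destruct (twist_turning_backward s e2 k) as [c [_ [hc _]]].
  { intros; apply hr. } { intros x hx; lra. }
  assert (E := twist_reflection c hc).
  (* The mirror image of [s] in the preceding turning time [c]: reflection reverses the sign of the
     derivative. *)
  exists (c - (s - c)).
  assert (h1 : is_derive (fun r => t (c + r)) (s - c) (t1 (c + (s - c)))).
  { auto_derive; [eexists; apply dt|].
    rewrite (is_derive_unique _ _ _ (dt _)); ring. }
  assert (h2 : is_derive (fun r => t (c + r)) (s - c) (- t1 (c - (s - c)))).
  { apply (is_derive_ext (fun r => t (c - r))); [intros; symmetry; apply E|].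
    auto_derive; [eexists; apply dt|].
    rewrite (is_derive_unique _ _ _ (dt _)). unfold Rminus; ring. }
  apply is_derive_unique in h1; apply is_derive_unique in h2.
  rewrite h1 in h2. replace (c + (s - c)) with s in h2 by ring. lra.
Qed.

Lemma twist_half_period : exists s0 s2, s0 < s2 /\ t s0 = e1 /\ t s2 = e2 /\
  t1 s0 = 0 /\ t1 s2 = 0 /\ forall s, s0 < s < s2 -> 0 < t1 s.
Proof.
  destruct twist_increases_somewhere as [s hs].
  destruct (twist_turning_forward s e2 hs) as [s2 [h1 [h2 [h3 h4]]]].
  { intros; apply hr. } { intros x hx; specialize (hr s); lra. }
  (* Reversing both time and sign keeps the motion rising, so the same lemma finds the preceding
     minimum. The strict inequalities [t (- r) < t s < t s2] then identify the two turning values as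
     [e1] and [e2]. *)
  destruct (first_turning_point (fun r => - t (- r)) (fun r => t1 (- r))
      (fun x => speed2 c1 c2 (- x)) (fun x => - phi c1 (- x)) (- s) (- e1))
    as [r [k1 [k2 k3]]].
  - apply is_derive_reverse_neg, dt.
  - intros u. rewrite Ropp_involutive.
    apply (is_derive_reverse t1 (fun s => phi c1 (t s))), dt1.
  - intros u. rewrite Ropp_involutive. apply en.
  - intros u. specialize (hr (- u)); lra.
  - rewrite Ropp_involutive. intros y hy.
    destruct (speed2_phi_regular (- y)) as [q1 [q2 q3]]; [specialize (hr s); lra|].
    repeat split.
    + apply (continuity_pt_comp Ropp (speed2 c1 c2)); [|exact q1].
      apply continuity_pt_opp, derivable_continuous_pt, derivable_pt_id.
    + apply continuity_pt_opp, (continuity_pt_comp Ropp (phi c1)); [|exact q2].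
      apply continuity_pt_opp, derivable_continuous_pt, derivable_pt_id.
    + intros z; specialize (q3 z); lra.
  - rewrite Ropp_involutive; exact hs.
  - assert (h5 : t (- r) < t s).
    { apply derive_pos_increasing with t1; [lra|exact dt|].
      intros u hu. replace u with (- - u) by ring. apply k3; lra. }
    exists (- r), s2.
    assert (q1 := hr s). assert (q2 := hr (- r)). assert (q3 := hr s2).
    split; [lra|]. split.
    { destruct (twist_turning_value (- r) k2) as [|[|]]; lra. }
    split.
    { destruct (twist_turning_value s2 h2) as [|[|]]; lra. }
    repeat split; try assumption.
    intros u hu. destruct (Rlt_or_le u s).
    + replace u with (- - u) by ring. apply k3; lra.
    + apply h3; lra.
Qed.

(** On [[e1, e2]] the square decreases and [x^2 - 3 l] has no zero, so its sign at [e2] is its sign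
    throughout. In the negative case a change of sign would put the zero [- sqrt (3 l)] inside the
    interval. *)
Lemma eigenform_sign l : Qc c1 c2 l = 0 -> Delta2 c1 c2 <> 0 ->
  exists sg, sg ^ 2 = 1 /\ forall x, e1 <= x <= e2 -> 0 < sg * (x ^ 2 - 3 * l).
Proof.
  intros hq hD.
  assert (hn : forall x, e1 <= x <= e2 -> x ^ 2 - 3 * l <> 0).
  { intros x hx. apply (eigenform_neq0 c1 c2); try assumption; [lra|].
    destruct (Req_dec x e1) as [->|n1]; [rewrite hP; lra|].
    destruct (Req_dec x e2) as [->|n2]; [rewrite hP; lra|].
    left. apply (Pc_pos_between c1 c2 e1 e2 e3 a b); try assumption; lra. }
  destruct (Rle_or_lt (3 * l) (e2 ^ 2)) as [h|h].
  - exists 1. split; [ring|]. intros x hx. specialize (hn x hx). nra.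
  - exists (-1). split; [ring|]. intros x hx.
    destruct (Rlt_or_le (x ^ 2) (3 * l)) as [k|k]; [lra|exfalso].
    apply (hn (- sqrt (3 * l))).
    + assert (hs : 0 <= 3 * l) by (pose proof (pow2_ge_0 e2); lra).
      assert (q := sqrt_sqrt (3 * l) hs). assert (q0 := sqrt_pos (3 * l)).
      split; nra.
    + assert (hs : 0 <= 3 * l) by (pose proof (pow2_ge_0 e2); lra).
      assert (q := sqrt_sqrt (3 * l) hs). nra.
Qed.

Lemma continuity_pt_integrand l x : e1 < x < e2 -> x ^ 2 - 3 * l <> 0 ->
  continuity_pt (integrand c1 c2 l) x.
Proof.
  intros hx hn. apply continuity_pt_filterlim.
  apply (ex_derive_continuous (integrand c1 c2 l)). unfold integrand.
  assert (p : 0 < Pc c1 c2 x)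
    by (apply (Pc_pos_between c1 c2 e1 e2 e3 a b); assumption).
  assert (q : 0 < sqrt (Pc c1 c2 x)) by (apply sqrt_lt_R0, p).
  assert (q2 : 0 < sqrt 2) by (apply sqrt_lt_R0; lra).
  auto_derive. repeat split; trivial.
  - exists (3 * x ^ 2 * phi c1 x + 2 / x * Pc c1 c2 x). apply is_derive_Pc; lra.
  - repeat apply Rmult_integral_contrapositive_currified; try lra.
Qed.

(** On a rising arc [tau < 0 < tau'], so the energy equation gives
    [sqrt P = sqrt (3/2) (- tau tau')]. This choice of the root yields the minus sign, hence the
    orientation of the integral from [e2] to [e1]. *)
Lemma twist_speed_integrand l s :
  0 < t1 s -> t s ^ 2 - 3 * l <> 0 ->
  c1 / t s ^ 2 + (l ^ 2 + 3 * c1 - 3 * t s) / (t s ^ 2 - 3 * l)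
  = - (t1 s * integrand c1 c2 l (t s)).
Proof.
  intros h1 hn. assert (hs := hr s).
  assert (q3 : 0 < sqrt 3) by (apply sqrt_lt_R0; lra).
  assert (q2 : 0 < sqrt 2) by (apply sqrt_lt_R0; lra).
  assert (E : sqrt (Pc c1 c2 (t s)) = sqrt 3 / sqrt 2 * (- t s * t1 s)).
  { rewrite twist_Pc, sqrt_mult_alt by lra. rewrite sqrt_div_alt by lra.
    f_equal. replace ((t s * t1 s) ^ 2) with ((- t s * t1 s) ^ 2) by ring.
    apply sqrt_pow2. apply Rmult_le_pos; lra. }
  unfold integrand. rewrite E. field. repeat split; try lra.
Qed.

End Twist.

(** * The closing condition *)

Definition eigenfactor (sg l : R) (t th : R -> R) (s : R) : C :=
  (RtoC (/ sqrt (sg * (t s ^ 2 - 3 * l)))%R * cis (th s))%C.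

(** The modulus is [D^2 / |D|] with [D = t^2 - 3 l]. It retains no phase and, up to sign, is affine
    in [l], so different eigenvalues can be compared. *)
Lemma normsq_eigenfactor sg l t th k t1 s :
  0 < sg * (t s ^ 2 - 3 * l) -> sg ^ 2 = 1 ->
  normsq (eigenfactor sg l t th s * x1 (eigenrow l k (t s) t1))%C
  = sg * (t s ^ 2 - 3 * l).
Proof.
  intros h hsg. unfold eigenfactor. rewrite !normsq_mult.
  assert (E1 : normsq (cis (th s)) = 1).
  { unfold normsq, cis; simpl. pose proof (sin2_cos2 (th s)) as q.
    unfold Rsqr in q. lra. }
  set (D := t s ^ 2 - 3 * l) in *.
  assert (E2 : normsq (RtoC (/ sqrt (sg * D))) = / (sg * D)).
  { unfold normsq; simpl. rewrite <- (sqrt_sqrt (sg * D)) at 3 by lra.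
    field. apply Rgt_not_eq, sqrt_lt_R0, h. }
  assert (E3 : normsq (x1 (eigenrow l k (t s) t1)) = D ^ 2).
  { unfold normsq, eigenrow, x1; simpl. unfold D; ring. }
  rewrite E1, E2, E3. replace (D ^ 2) with ((sg * D) * (sg * D)).
  - field. split; intros k0; rewrite k0 in h; lra.
  - transitivity (sg ^ 2 * D ^ 2); [ring|rewrite hsg; ring].
Qed.

Lemma eigenfactor_neq0 sg l t th s :
  0 < sg * (t s ^ 2 - 3 * l) -> eigenfactor sg l t th s <> 0%C.
Proof.
  intros h k. unfold eigenfactor in k.
  assert (h1 : 0 < / sqrt (sg * (t s ^ 2 - 3 * l)))
    by (apply Rinv_0_lt_compat, sqrt_lt_R0, h).
  apply C_mult_eq0_r in k.
  - injection k; intros ks kc. pose proof (sin2_cos2 (th s)) as q.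
    rewrite ks, kc in q. unfold Rsqr in q. lra.
  - intros z. apply RtoC_inj in z; lra.
Qed.

Lemma rdot_scal r c v : rdot r (scal3 c v) = (c * rdot r v)%C.
Proof. unfold rdot, scal3, x1, x2, x3; simpl; ring. Qed.

Lemma represents_line z p w : represents z p ->
  line p w <-> exists k, w = scal3 k z.
Proof.
  intros [hz hl]. destruct (line_spanned p) as [v [hv hp]].
  destruct (proj1 (hp z) hl) as [m ->].
  assert (hm : m <> 0%C).
  { intros ->. apply hz. unfold scal3, zero3. f_equal; [f_equal|]; ring. }
  assert (ss : forall a b u, scal3 a (scal3 b u) = scal3 (a * b)%C u)
    by (intros a b u; unfold scal3, x1, x2, x3; simpl; f_equal; [f_equal|]; ring).
  rewrite hp. split; intros [k ->].
  - exists (k / m)%C. rewrite ss. f_equal. field. exact hm.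
  - exists (k * m)%C. apply ss.
Qed.

Lemma represents_eq z p q : represents z p -> represents z q -> p = q.
Proof.
  intros hp hq. apply line_ext. intros w.
  rewrite (represents_line z p w hp), (represents_line z q w hq). reflexivity.
Qed.

Lemma frame_col1_represents g F kappa tau :
  wilczynski_frame g (fun _ => 1) F kappa tau ->
  forall s, represents (col1 (F s)) (g s).
Proof.
  intros [[G [[[_ hG] _] [_ hF]]] _] s.
  replace (col1 (F s)) with (G s); [apply hG|].
  rewrite hF. unfold scal3. destruct (G s) as [[u v] w].
  unfold x1, x2, x3; simpl. f_equal; [f_equal|]; ring.
Qed.

(* A row [r] with [r F = y], where [y] is the solution of [y' = y K] built on
   the eigenvalue [l]; its phase advances by [2 PI frakP] over one period of the twist. *)
Definition eigen_coordinates (F : R -> M3) (k t t1 : R -> R) (w l pl : R)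
    (r : C3) (sg : R) (th : R -> R) : Prop :=
  sg ^ 2 = 1 /\
  (forall s, 0 < sg * (t s ^ 2 - 3 * l)) /\
  (forall s, th (s + w) = th s + 2 * PI * pl) /\
  (forall s,
     rdot r (col1 (F s)) = (eigenfactor sg l t th s * x1 (eigenrow l (k s) (t s) (t1 s)))%C /\
     rdot r (col2 (F s)) = (eigenfactor sg l t th s * x2 (eigenrow l (k s) (t s) (t1 s)))%C /\
     rdot r (col3 (F s)) = (eigenfactor sg l t th s * x3 (eigenrow l (k s) (t s) (t1 s)))%C).

Lemma eigen_coordinates_shift F k t t1 w l pl r sg th :
  eigen_coordinates F k t t1 w l pl r sg th ->
  (forall s, t (s + w) = t s) -> (forall s, k (s + w) = k s) ->
  (forall s, t1 (s + w) = t1 s) ->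
  forall (n : Z) s,
    rdot r (col1 (F (s + IZR n * w))) = (cis (2 * PI * (IZR n * pl)) * rdot r (col1 (F s)))%C /\
    rdot r (col2 (F (s + IZR n * w))) = (cis (2 * PI * (IZR n * pl)) * rdot r (col2 (F s)))%C /\
    rdot r (col3 (F (s + IZR n * w))) = (cis (2 * PI * (IZR n * pl)) * rdot r (col3 (F s)))%C.
Proof.
  intros [_ [_ [hth hr]]] pt pk pt1 n s.
  assert (per : forall f : R -> R, (forall s, f (s + w) = f s) -> f (s + IZR n * w) = f s).
  { intros f hf. rewrite (quasi_periodic_IZR f w 0); [ring|].
    intros u; rewrite hf; ring. }
  destruct (hr s) as [-> [-> ->]].
  destruct (hr (s + IZR n * w)) as [-> [-> ->]].
  assert (E : eigenfactor sg l t th (s + IZR n * w)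
              = (cis (2 * PI * (IZR n * pl)) * eigenfactor sg l t th s)%C).
  { unfold eigenfactor. rewrite (per t pt), (quasi_periodic_IZR th w _ hth), cis_plus.
    replace (IZR n * (2 * PI * pl)) with (2 * PI * (IZR n * pl)) by ring. ring. }
  rewrite E, (per t pt), (per k pk), (per t1 pt1).
  repeat split; ring.
Qed.

Lemma derivative_periodic (f f' : R -> R) w :
  (forall s, is_derive f s (f' s)) -> (forall s, f (s + w) = f s) ->
  forall s, f' (s + w) = f' s.
Proof.
  intros df per s.
  rewrite <- (is_derive_unique _ _ _ (df s)), <- (Derive_ext (fun s => f (s + w)) f) by exact per.
  symmetry. apply is_derive_unique.
  auto_derive; [eexists; apply df|].
  rewrite (is_derive_unique _ _ _ (df _)). ring.
Qed.

Lemma normsq_pos_neq0 z : 0 < normsq z -> z <> 0%C.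
Proof. intros h ->. unfold normsq in h; simpl in h. lra. Qed.

Section Closing.
Variables (g : R -> CP2) (F : R -> M3) (k t t1 : R -> R) (w s0 : R).
Variables (l1 l2 l3 p1 p2 p3 : R) (r1 r2 r3 : C3) (sg1 sg2 sg3 : R)
  (th1 th2 th3 : R -> R).
Hypothesis hw : 0 < w.
Hypothesis hg : forall s, represents (col1 (F s)) (g s).
Hypothesis hF : forall s, det3 (col1 (F s)) (col2 (F s)) (col3 (F s)) = 1%C.
Hypothesis pt : forall s, t (s + w) = t s.
Hypothesis pk : forall s, k (s + w) = k s.
Hypothesis pt1 : forall s, t1 (s + w) = t1 s.
Hypothesis tneg : forall s, t s < 0.
Hypothesis t1nz : exists s, t1 s <> 0.
Hypothesis hmin : forall s, t s = t s0 -> exists n : Z, s = s0 + IZR n * w.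
Hypotheses (h12 : l1 < l2) (h23 : l2 < l3).
Hypothesis E1 : eigen_coordinates F k t t1 w l1 p1 r1 sg1 th1.
Hypothesis E2 : eigen_coordinates F k t t1 w l2 p2 r2 sg2 th2.
Hypothesis E3 : eigen_coordinates F k t t1 w l3 p3 r3 sg3 th3.

(** The rows [r_j F] are nonzero multiples of the eigenrows, and [det F = 1]. The determinant of the
    constant rows can thus be tested at a single time with [t1 <> 0]. *)
Lemma eigen_rows_independent : det3 r1 r2 r3 <> 0%C.
Proof.
  destruct t1nz as [s hs]. intros h0.
  assert (D := det3_rdot r1 r2 r3 (col1 (F s)) (col2 (F s)) (col3 (F s))).
  rewrite h0 in D.
  destruct E1 as [_ [q1 [_ R1]]], E2 as [_ [q2 [_ R2]]], E3 as [_ [q3 [_ R3]]].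
  destruct (R1 s) as [A1 [A2 A3]], (R2 s) as [B1 [B2 B3]], (R3 s) as [C1 [C2 C3]].
  rewrite A1, A2, A3, B1, B2, B3, C1, C2, C3 in D.
  assert (D' := det3_scal (eigenfactor sg1 l1 t th1 s) (eigenfactor sg2 l2 t th2 s)
     (eigenfactor sg3 l3 t th3 s) (eigenrow l1 (k s) (t s) (t1 s))
     (eigenrow l2 (k s) (t s) (t1 s)) (eigenrow l3 (k s) (t s) (t1 s))).
  unfold scal3 in D'. rewrite D in D'.
  assert (Z : (eigenfactor sg1 l1 t th1 s * (eigenfactor sg2 l2 t th2 s *
     (eigenfactor sg3 l3 t th3 s * det3 (eigenrow l1 (k s) (t s) (t1 s))
     (eigenrow l2 (k s) (t s) (t1 s)) (eigenrow l3 (k s) (t s) (t1 s)))))%C = 0%C).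
  { transitivity (0 * det3 (col1 (F s)) (col2 (F s)) (col3 (F s)))%C;
      [rewrite D'; ring|ring]. }
  do 3 (apply C_mult_eq0_r in Z; [|apply eigenfactor_neq0; auto]).
  rewrite det3_eigenrow in Z.
  apply C_mult_eq0_r in Z.
  - injection Z; intros; lra.
  - intros z. injection z. intros z'.
    assert (0 < (l2 - l1) * (l3 - l1) * (l3 - l2))
      by (repeat apply Rmult_lt_0_compat; lra). lra.
Qed.

Lemma closed_of_rational :
  is_rational p1 -> is_rational p2 -> is_rational p3 -> closed_curve g.
Proof.
  intros h1 h2 h3.
  destruct (is_rational_multiple _ h1) as [n1 [q1 [m1 k1]]].
  destruct (is_rational_multiple _ h2) as [n2 [q2 [m2 k2]]].
  destruct (is_rational_multiple _ h3) as [n3 [q3 [m3 k3]]].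
  (* A common denominator: after [n] periods of the twist all three multipliers equal 1, and [F_1]
     returns as a vector. *)
  set (n := (n1 * n2 * n3)%Z).
  assert (hn : (0 < n)%Z) by (unfold n; lia).
  exists (IZR n * w). split.
  { apply Rmult_lt_0_compat; [apply IZR_lt, hn|exact hw]. }
  intros s. apply represents_eq with (col1 (F s)); [|apply hg].
  replace (col1 (F s)) with (col1 (F (s + IZR n * w))); [apply hg|].
  assert (U : forall (m : Z) x, x = IZR m -> cis (2 * PI * x) = 1%C)
    by (intros m x ->; apply cis_2PI with m; reflexivity).
  apply (rdot_inj r1 r2 r3 _ _ eigen_rows_independent).
  - destruct (eigen_coordinates_shift _ _ _ _ _ _ _ _ _ _ E1 pt pk pt1 n s) as [-> _].
    rewrite (U (m1 * n2 * n3)%Z); [ring|].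
    unfold n. rewrite !mult_IZR, <- k1. ring.
  - destruct (eigen_coordinates_shift _ _ _ _ _ _ _ _ _ _ E2 pt pk pt1 n s) as [-> _].
    rewrite (U (n1 * m2 * n3)%Z); [ring|].
    unfold n. rewrite !mult_IZR, <- k2. ring.
  - destruct (eigen_coordinates_shift _ _ _ _ _ _ _ _ _ _ E3 pt pk pt1 n s) as [-> _].
    rewrite (U (n1 * n2 * m3)%Z); [ring|].
    unfold n. rewrite !mult_IZR, <- k3. ring.
Qed.

(* [|r_j . F_1|^2 = |t^2 - 3 l_j|], so comparing three values of [j] gives both
   [|eps| = 1] and the periodicity of the twist. *)
Lemma closing_preserves_twist T : (forall s, g (s + T) = g s) ->
  forall s, t (s + T) = t s.
Proof.
  intros hT s.
  assert (L : line (g s) (col1 (F (s + T)))) by (rewrite <- hT; apply hg).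
  apply (represents_line _ _ _ (hg s)) in L. destruct L as [eps L].
  assert (N : forall l p r sg th, eigen_coordinates F k t t1 w l p r sg th ->
    t (s + T) ^ 2 - 3 * l = normsq eps * (t s ^ 2 - 3 * l)).
  { intros l p r sg th [hsg [hq [_ hr]]].
    destruct (hr s) as [A1 _], (hr (s + T)) as [B1 _].
    rewrite L, rdot_scal, A1 in B1. apply (f_equal normsq) in B1.
    rewrite normsq_mult, !normsq_eigenfactor in B1 by (apply hq || exact hsg).
    apply (Rmult_eq_reg_l sg); [lra|]. intros ->. simpl in hsg; lra. }
  assert (N1 := N _ _ _ _ _ E1). assert (N2 := N _ _ _ _ _ E2).
  assert (he : normsq eps = 1).
  { apply (Rmult_eq_reg_l (l2 - l1)); [|lra]. lra. }
  (* Once [|eps| = 1], the squares of the two twist values agree, and both values are negative. *)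
  rewrite he in N1. assert (a := tneg s). assert (b := tneg (s + T)). nra.
Qed.

(** The closing time is [n w], and each [r_j F_1] is nonzero, so all three multipliers equal the
    projective factor [eps] of [F_1]. Independence of the rows then scales every column of [F] by
    [eps], and [det F = 1] gives [eps^3 = 1]. *)
Lemma rational_of_closed :
  closed_curve g -> is_rational p1 /\ is_rational p2 /\ is_rational p3.
Proof.
  intros [T [hT0 hT]].
  destruct (hmin (s0 + T)) as [n hn].
  { apply closing_preserves_twist, hT. }
  assert (hTn : T = IZR n * w) by lra.
  assert (hn0 : (0 < n)%Z).
  { apply lt_IZR. apply (Rmult_lt_reg_r w); [exact hw|]. lra. }
  assert (L : line (g s0) (col1 (F (s0 + IZR n * w))))
    by (rewrite <- hT, hTn; apply hg).
  apply (represents_line _ _ _ (hg s0)) in L. destruct L as [eps L].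
  assert (N : forall l p r sg th, eigen_coordinates F k t t1 w l p r sg th ->
    cis (2 * PI * (IZR n * p)) = eps).
  { intros l p r sg th hE.
    destruct (eigen_coordinates_shift _ _ _ _ _ _ _ _ _ _ hE pt pk pt1 n s0) as [S _].
    rewrite L, rdot_scal in S.
    destruct hE as [hsg [hq [_ hr]]]. destruct (hr s0) as [A1 _].
    assert (hz : rdot r (col1 (F s0)) <> 0%C).
    { apply normsq_pos_neq0. rewrite A1, normsq_eigenfactor by (apply hq || exact hsg).
      apply hq. }
    assert (Z : (rdot r (col1 (F s0)) * (cis (2 * PI * (IZR n * p)) - eps))%C = 0%C).
    { transitivity (cis (2 * PI * (IZR n * p)) * rdot r (col1 (F s0))
        - eps * rdot r (col1 (F s0)))%C; [ring|rewrite <- S; ring]. }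
    apply C_mult_eq0_r in Z; [|exact hz].
    transitivity (cis (2 * PI * (IZR n * p)) - eps + eps)%C; [ring|rewrite Z; ring]. }
  assert (N1 := N _ _ _ _ _ E1). assert (N2 := N _ _ _ _ _ E2).
  assert (N3 := N _ _ _ _ _ E3).
  destruct (eigen_coordinates_shift _ _ _ _ _ _ _ _ _ _ E1 pt pk pt1 n s0) as [a1 [a2 a3]].
  destruct (eigen_coordinates_shift _ _ _ _ _ _ _ _ _ _ E2 pt pk pt1 n s0) as [b1 [b2 b3]].
  destruct (eigen_coordinates_shift _ _ _ _ _ _ _ _ _ _ E3 pt pk pt1 n s0) as [d1 [d2 d3]].
  rewrite N1 in a1, a2, a3. rewrite N2 in b1, b2, b3. rewrite N3 in d1, d2, d3.
  rewrite <- rdot_scal in a1, a2, a3, b1, b2, b3, d1, d2, d3.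
  assert (M1 := rdot_inj r1 r2 r3 _ _ eigen_rows_independent a1 b1 d1).
  assert (M2 := rdot_inj r1 r2 r3 _ _ eigen_rows_independent a2 b2 d2).
  assert (M3 := rdot_inj r1 r2 r3 _ _ eigen_rows_independent a3 b3 d3).
  assert (Deps : (eps * eps * eps)%C = 1%C).
  { assert (h := hF (s0 + IZR n * w)). rewrite M1, M2, M3, det3_scal, hF in h.
    rewrite <- h. ring. }
  assert (fin : forall p, cis (2 * PI * (IZR n * p)) = eps -> is_rational p).
  { intros p hp. rewrite <- hp in Deps.
    destruct (cis_cube_eq_1 _ Deps) as [m hm].
    (* The 3 in the denominator accounts for [eps] being a cube root of unity and not necessarily
       1. *)
    replace p with (IZR m / IZR (3 * n)).
    - apply is_rational_IZR_div. lia.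
    - assert (IZR n <> 0) by (apply not_0_IZR; lia).
      rewrite mult_IZR. apply (Rmult_eq_reg_l (3 * (2 * PI) * IZR n)).
      + transitivity (2 * PI * IZR m); [field; assumption|]. rewrite <- hm. ring.
      + pose proof PI_RGT_0. apply Rmult_integral_contrapositive_currified; [lra|assumption]. }
  repeat split; apply fin; assumption.
Qed.
End Closing.

Theorem mainTheorem4 (g : R -> CP2) (F : R -> M3) (kappa tau : R -> R)
    (c1 c2 e1 e2 e3 l1 l2 l3 : R) :
  critical g ->
  natural_parameter g ->
  wilczynski_frame g (fun _ => 1) F kappa tau ->
  has_modulus kappa tau c1 c2 ->
  general c1 c2 ->
  type_B1' tau c1 c2 ->
  e1 < e2 < e3 ->
  Pc c1 c2 e1 = 0 -> Pc c1 c2 e2 = 0 -> Pc c1 c2 e3 = 0 ->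
  l1 = - (l2 + l3) -> l1 < 0 -> 0 < l2 -> l2 < l3 ->
  Qc c1 c2 l1 = 0 -> Qc c1 c2 l2 = 0 -> Qc c1 c2 l3 = 0 ->
  (closed_curve g <->
     is_rational (frakP c1 c2 e1 e2 l1) /\
     is_rational (frakP c1 c2 e1 e2 l2) /\
     is_rational (frakP c1 c2 e1 e2 l3)).
Proof.
  intros _ _ hW hmod hgen [HB [nc [_ hcomp]]] he P1 P2 P3 hl1 hl1n hl2 hl23 Q1 Q2 Q3.
  assert (hc1 := in_B1_c1_neg _ _ HB).
  destruct (Pc_roots_sign _ _ _ _ _ HB he P1 P2 P3) as [he2 he3].
  destruct (in_B1_real_factor _ _ _ _ _ HB he P1 P2 P3) as [a [b [hb hP]]].
  destruct he as [he1 _].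
  assert (hD2 : Delta2 c1 c2 <> 0)
    by (intros h; apply hgen; rewrite h; ring).
  assert (hg := frame_col1_represents _ _ _ _ hW).
  destruct hW as [_ [hFs [hks [hts hF]]]].
  assert (hm1 : forall s, kappa s * tau s ^ 2 = c1) by (intros s; apply hmod).
  assert (t0 : forall s, tau s <> 0).
  { intros s h. specialize (hm1 s). rewrite h in hm1. lra. }
  assert (kE : forall s, kappa s = c1 / tau s ^ 2).
  { intros s. rewrite <- (hm1 s). field. apply t0. }
  assert (en : forall s, Derive tau s ^ 2 = speed2 c1 c2 (tau s)).
  { intros s. destruct (hmod s) as [_ h]. rewrite kE in h. unfold speed2.
    rewrite <- h. field. apply t0. }
  assert (dt : forall s, is_derive tau s (Derive tau s))
    by (intros s; apply smooth_is_derive, hts).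
  destruct nc as [u [u' hu]].
  assert (dt1 := energy_euler_lagrange tau c1 c2 u u' hts t0 en hu).
  assert (nc : exists s s', tau s <> tau s') by (exists u, u'; exact hu).
  destruct (compact_fst_bounded _ hcomp) as [M hM].
  assert (hM' : forall s, tau s <= M).
  { intros s. apply (hM (tau s, sqrt (3 / 2) * tau s * Derive tau s)).
    exists s; reflexivity. }
  assert (hr := twist_range tau (Derive tau) c1 c2 e1 e2 e3 a b he1 he2 he3 hb hP
    dt dt1 en t0 nc M hM').
  destruct (twist_half_period tau (Derive tau) c1 c2 e1 e2 e3 a b he1 he2 he3 hb hP
    dt dt1 en t0 nc hr) as [s0 [s2 [hs [ts0 [ts2 [z0 [z2 hpos]]]]]]].
  assert (refl := twist_reflection tau (Derive tau) c1 e1 e2 he1 he2 dt dt1 hr).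
  set (w := 2 * (s2 - s0)).
  assert (hw : 0 < w) by (unfold w; lra).
  (* The reflections about [s2] and [s0] compose to the translation by [w]. *)
  assert (pt : forall s, tau (s + w) = tau s).
  { intros s.
    replace (s + w) with (s2 + (s + w - s2)) by ring. rewrite (refl s2 z2).
    replace (s2 - (s + w - s2)) with (s0 + (s0 - s)) by (unfold w; ring).
    rewrite (refl s0 z0). f_equal; ring. }
  assert (pt1 := derivative_periodic tau (Derive tau) w dt pt).
  assert (pk : forall s, kappa (s + w) = kappa s)
    by (intros s; rewrite !kE, pt; reflexivity).
  assert (hmin : forall s, tau s = tau s0 -> exists n : Z, s = s0 + IZR n * w)
    by exact (oscillation_min_times tau (Derive tau) s0 s2 hs dt hpos (refl s2 z2) pt).
  assert (dk : forall s, is_derive kappa s (Derive kappa s))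
    by (intros s; apply smooth_is_derive, hks).
  (* The first Euler-Lagrange equation, from differentiating [kappa tau^2 = c1] and cancelling
     [tau]. *)
  assert (hk1 : forall s, tau s * Derive kappa s = - 2 * kappa s * Derive tau s).
  { intros s.
    assert (h1 : is_derive (fun s => kappa s * tau s ^ 2) s
      (Derive kappa s * tau s ^ 2 + kappa s * (2 * tau s * Derive tau s))).
    { auto_derive; [repeat split; eexists; [apply dk|apply dt]|].
      rewrite !(is_derive_unique _ _ _ (dt _)), !(is_derive_unique _ _ _ (dk _)). ring. }
    apply (is_derive_ext _ (fun _ => c1) s _ hm1), is_derive_unique in h1.
    rewrite Derive_const in h1.
    apply (Rmult_eq_reg_l (tau s)); [|apply t0]. lra. }
  assert (dt1' : forall s, is_derive (Derive tau) s (tau s ^ 2 - 9 * kappa s * (1 - kappa s * tau s))).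
  { intros s. replace (tau s ^ 2 - 9 * kappa s * (1 - kappa s * tau s)) with (phi c1 (tau s));
      [apply dt1|]. rewrite kE. unfold phi. field. apply t0. }
  assert (package : forall l, Qc c1 c2 l = 0 -> exists r sg th,
    eigen_coordinates F kappa tau (Derive tau) w l (frakP c1 c2 e1 e2 l) r sg th).
  { intros l hl.
    destruct (eigenform_sign c1 c2 e1 e2 e3 a b he1 he2 he3 hb hP l hl hD2) as [sg [hsg1 hsg]].
    assert (hq : forall s, 0 < sg * (tau s ^ 2 - 3 * l)) by (intros s; apply hsg, hr).
    assert (hq0 : forall s, tau s ^ 2 - 3 * l <> 0)
      by (intros s h; specialize (hq s); rewrite h in hq; lra).
    (* The phase speed with [kappa] eliminated: as a function of [tau] alone it inherits the
       reflection symmetry and the period. *)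
    set (h := fun s => c1 / tau s ^ 2 + (l ^ 2 + 3 * c1 - 3 * tau s) / (tau s ^ 2 - 3 * l)).
    destruct (exists_primitive h) as [th dth].
    { intros s. apply continuity_pt_filterlim, (ex_derive_continuous h).
      unfold h. assert (n1 := t0 s). assert (n2 := hq0 s).
      auto_derive. repeat split; try (eexists; apply dt); simpl in *;
        [repeat apply Rmult_integral_contrapositive_currified; lra|exact n2]. }
    assert (hperiod : forall s, th (s + w) = th s + 2 * (th s2 - th s0)).
    { apply primitive_over_period with h; [exact dth| |].
      - intros r. unfold h. rewrite (refl s2 z2). reflexivity.
      - intros r. unfold h. fold w. rewrite pt. reflexivity. }
    assert (hint : is_RInt_gen (integrand c1 c2 l) (at_left (tau s2)) (at_right (tau s0))
                     (th s2 - th s0)).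
    { apply is_RInt_gen_substitution with (Derive tau); try assumption.
      - intros s. eapply is_derive_continuity_pt, dt1.
      - rewrite ts0, ts2. intros y hy.
        apply (continuity_pt_integrand c1 c2 e1 e2 e3 a b); try assumption.
        intros k. specialize (hsg y ltac:(lra)). rewrite k in hsg. lra.
      - intros s. eapply is_derive_continuity_pt, dth.
      - intros s hss.
        rewrite <- (twist_speed_integrand tau (Derive tau) c1 c2 e1 e2 he2 en t0 hr l s);
          [apply dth|apply hpos, hss|apply hq0]. }
    rewrite ts0, ts2 in hint.
    assert (hfrak : th s2 - th s0 = PI * frakP c1 c2 e1 e2 l).
    { unfold frakP. rewrite (is_RInt_gen_unique _ _ hint).
      field. apply PI_neq0. }
    destruct (frame_row_exists F kappa tau _ _ _ hFs
       (fun s => conj (proj1 (hF s)) (proj2 (hF s)))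
       (eigenrow_solution l c1 c2 sg kappa tau (Derive tau) (Derive kappa) th hl dt dt1' dk hk1
          hm1 (fun s => proj2 (hmod s)) hq
          (fun s => ltac:(rewrite kE; exact (dth s))))) as [r hrow].
    exists r, sg, th. split; [exact hsg1|]. split; [exact hq|]. split; [|exact hrow].
    intros s. rewrite hperiod, hfrak. ring. }
  destruct (package l1 Q1) as [r1 [sg1 [th1 E1]]].
  destruct (package l2 Q2) as [r2 [sg2 [th2 E2]]].
  destruct (package l3 Q3) as [r3 [sg3 [th3 E3]]].
  assert (hdet : forall s, det3 (col1 (F s)) (col2 (F s)) (col3 (F s)) = 1%C)
    by (intros s; apply hF).
  assert (tneg : forall s, tau s < 0) by (intros s; specialize (hr s); lra).
  assert (nz : exists s, Derive tau s <> 0).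
  { exists ((s0 + s2) / 2). apply Rgt_not_eq, hpos. lra. }
  split.
  - intros hcl. exact (rational_of_closed g F kappa tau (Derive tau) w s0 l1 l2 l3 _ _ _
      r1 r2 r3 sg1 sg2 sg3 th1 th2 th3 hw hg hdet pt pk pt1 tneg nz hmin ltac:(lra) hl23
      E1 E2 E3 hcl).
  - intros [q1 [q2 q3]].
    exact (closed_of_rational g F kappa tau (Derive tau) w l1 l2 l3 _ _ _
      r1 r2 r3 sg1 sg2 sg3 th1 th2 th3 hw hg pt pk pt1 nz ltac:(lra) hl23
      E1 E2 E3 q1 q2 q3).
Qed.
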